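(* Let $M$ be an $n$-dimensional $CR$ submanifold of maximal $CR$ dimension in an $(n+p)$-dimensional complex space form $(\overline{M},J,\overline{g})$, where $n\geq 3$ and the constant holomorphic sectional curvature of $\overline{M}$ equals $4c$. Let the distinguished vector field $\xi$ be parallel with respect to the normal connection $D$ and let $A$ be the shape operator of $\xi$. If $\nabla A=0$ on $M$, then $\overline{M}$ is a Euclidean space.
   Context: A complex space form is a Kaehler manifold $\overline{M}$ with complex structure $J$ and Kaehler metric $\overline{g}$, of constant holomorphic sectional curvature, denoted $4c$. The dimensions $n$ of $M$ and $n+p$ of $\overline{M}$ are real dimensions, so the normal bundle of $M$ has rank $p$. Let $M$ be an $n$-dimensional real submanifold immersed in $\overline{M}$, with the Riemannian metric $g$ induced from $\overline{g}$; tangent vectors of $M$ are identified with their images under the differential of the immersion. For $x\in M$ put $H_x(M)=JT_x(M)\cap T_x(M)$, the maximal complex subspace of $T_x(M)$. $M$ is called a $CR$ submanifold of maximal $CR$ dimension if $\dim_{\mathbb{C}}H_x(M)=\frac{n-1}{2}$ for every $x\in M$. In this case there is a unit vector field $\xi$ normal to $M$ such that $JT_x(M)\subset T_x(M)\oplus\mathrm{span}\{\xi_x\}$ for every $x\in M$; this $\xi$ is called the distinguished vector field. Let $\overline{\nabla}$ and $\nabla$ be the Riemannian (Levi-Civita) connections of $\overline{M}$ and $M$, respectively, and let $D$ be the normal connection induced from $\overline{\nabla}$ in the normal bundle of $M$. The shape operator $A$ of $\xi$ is the symmetric endomorphism of the tangent bundle $T(M)$ defined by $\overline{\nabla}_X\xi=-AX+D_X\xi$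 for $X$ tangent to $M$. That $\xi$ is parallel with respect to $D$ means $D_X\xi=0$ for all $X$ tangent to $M$. The condition $\nabla A=0$ means $(\nabla_XA)Y=\nabla_X(AY)-A(\nabla_XY)=0$ for all vector fields $X,Y$ tangent to $M$.
   Formalization: ''Is a Euclidean space'' is proved in the local sense: every point of M̄ has a neighbourhood isometric to an open subset of R^(n+p); the global claim fails for a flat complex torus containing a piece of a real hyperplane, as complex space forms are not assumed complete or simply connected. *)

(* Defs.v *)
From HB Require Import structures.
From mathcomp Require Import all_boot all_order all_algebra.
From mathcomp Require Import all_classical all_reals all_analysis.

Set Implicit Arguments.
Unset Strict Implicit.
Unset Printing Implicit Defensive.

Import Order.TTheory GRing.Theory Num.Theory.
Import numFieldNormedType.Exports.

Local Open Scope classical_set_scope.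
Local Open Scope ring_scope.

(* Tangent vectors are row vectors of components in a chart and linear maps act
   on the right: the differential of F at y sends v to [v *m 'J F y], an
   endomorphism E sends v to [v *m E], and a subspace is the row space of a
   matrix.  All dimensions are real unless stated otherwise. *)

Section Calculus.
Context {R : realType}.

Definition partial n (i : 'I_n) (f : 'rV[R]_n -> R) (y : 'rV[R]_n) : R :=
  'D_(delta_mx 0 i) f y.

(* Meant for open V. *)
Fixpoint C_k n (k : nat) (V : set 'rV[R]_n) (f : 'rV[R]_n -> R) : Prop :=
  match k with
  | 0 => forall y, V y -> {for y, continuous f}
  | k'.+1 => (forall y, V y -> differentiable f y) /\
             (forall i, C_k k' V (partial i f))
  end.

Definition smooth_on n m1 m2 (V : set 'rV[R]_n)
    (F : 'rV[R]_n -> 'M[R]_(m1, m2)) : Prop :=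
  forall i j k, C_k k V (fun y => F y i j).

End Calculus.

(* Riemannian geometry of a metric G given by its matrix of components on an
   open subset of R^n. *)
Section LocalGeometry.
Context {R : realType}.

Definition ip n (G : 'M[R]_n) (u v : 'rV[R]_n) : R := (u *m G *m v^T) 0 0.

(* Gamma^k_{ij}
     = 1/2 g^{kl} (d_i g_{jl} + d_j g_{il} - d_l g_{ij}) *)
Definition christoffel n (G : 'rV[R]_n -> 'M[R]_n) (y : 'rV[R]_n)
    (i j k : 'I_n) : R :=
  2^-1 * \sum_l (invmx (G y)) k l *
    (partial i (fun z => G z j l) y + partial j (fun z => G z i l) y
     - partial l (fun z => G z i j) y).

Definition Gamma n (G : 'rV[R]_n -> 'M[R]_n) (y u v : 'rV[R]_n) : 'rV[R]_n :=
  \row_k \sum_i \sum_j christoffel G y i j k * u 0 i * v 0 j.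

(* The Levi-Civita covariant derivative, in the direction u at y, of a vector
   field xi along F : R^m -> (R^n, G). *)
Definition nabla_along m n (G : 'rV[R]_n -> 'M[R]_n)
    (F : 'rV[R]_m -> 'rV[R]_n) (u : 'rV[R]_m) (xi : 'rV[R]_m -> 'rV[R]_n)
    (y : 'rV[R]_m) : 'rV[R]_n :=
  'D_u xi y + Gamma G (F y) (u *m 'J F y) (xi y).

Definition nabla n (G : 'rV[R]_n -> 'M[R]_n) (X Y : 'rV[R]_n -> 'rV[R]_n)
    (y : 'rV[R]_n) : 'rV[R]_n :=
  'D_(X y) Y y + Gamma G y (X y) (Y y).

(* R(u, v)w, where u, v, w are extended to constant-coefficient fields: these
   commute, so there is no bracket term. *)
Definition curvature n (G : 'rV[R]_n -> 'M[R]_n) (y u v w : 'rV[R]_n) :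
    'rV[R]_n :=
  nabla G (cst u) (nabla G (cst v) (cst w)) y
  - nabla G (cst v) (nabla G (cst u) (cst w)) y.

Definition sectional n (G : 'rV[R]_n -> 'M[R]_n) (y u v : 'rV[R]_n) : R :=
  ip (G y) (curvature G y u v v) u
  / (ip (G y) u u * ip (G y) v v - ip (G y) u v ^+ 2).

(* (nabla_X E) Y = nabla_X (E Y) - E (nabla_X Y) is tensorial in X and Y, so
   fields X, Y on a coordinate domain V do the job of global ones. *)
Definition parallel_on n (V : set 'rV[R]_n) (G E : 'rV[R]_n -> 'M[R]_n) :
    Prop :=
  forall X Y : 'rV[R]_n -> 'rV[R]_n, smooth_on V X -> smooth_on V Y ->
  forall y, V y ->
    nabla G X (fun z => Y z *m E z) y - nabla G X Y y *m E y = 0.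

(* Component of w orthogonal, for the inner product G, to the row space of D
   (the rows of D being linearly independent). *)
Definition normal_part n m (G : 'M[R]_m) (D : 'M[R]_(n, m)) (w : 'rV[R]_m) :
    'rV[R]_m :=
  w - w *m G *m D^T *m invmx (D *m G *m D^T) *m D.

End LocalGeometry.

Section Manifolds.
Context {R : realType}.

Record chart (M : topologicalType) (n : nat) := Chart {
  dom : set M;
  coord :> M -> 'rV[R]_n;
  point_at : 'rV[R]_n -> M;
  dom_open : open dom;
  img_open : open (coord @` dom);
  coordK : forall x, dom x -> point_at (coord x) = x;
  coord_continuous : forall x, dom x -> {for x, continuous coord};
  point_at_continuous :
    forall y, (coord @` dom) y -> {for y, continuous point_at} }.

Definition img M n (a : chart M n) : set 'rV[R]_n := a @` dom a.

Definition transition M n (a b : chart M n) : 'rV[R]_n -> 'rV[R]_n :=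
  b \o point_at a.

(* Connectedness is not required. *)
Record manifold (n : nat) := Manifold {
  carrier :> topologicalType;
  idx : Type;
  atlas : idx -> chart carrier n;
  carrier_nonempty : exists x : carrier, True;
  carrier_hausdorff : hausdorff_space carrier;
  carrier_second_countable : @second_countable carrier;
  atlas_cover : forall x : carrier, exists a, dom (atlas a) x;
  atlas_smooth : forall a b,
    smooth_on (atlas a @` (dom (atlas a) `&` dom (atlas b)))
              (transition (atlas a) (atlas b)) }.

Definition in_chart n (M : manifold n) (a : idx M) T (h : M -> T) :
    'rV[R]_n -> T := h \o point_at (atlas a).

Definition Jac_transition n (M : manifold n) (a b : idx M) (x : M) :
    'M[R]_n :=
  'J (transition (atlas a) (atlas b)) (atlas a x).

(* [met a x] is the matrix (g_{ij}) at x in the chart a; it is meaningful for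
   x in the domain of a only. *)
Record metric n (M : manifold n) := Metric {
  met :> idx M -> M -> 'M[R]_n;
  met_smooth : forall a, smooth_on (img (atlas a)) (in_chart a (met a));
  met_sym : forall a x, dom (atlas a) x -> (met a x)^T = met a x;
  met_pos : forall a x, dom (atlas a) x ->
    forall v, v != 0 -> 0 < ip (met a x) v v;
  met_tensor : forall a b x, dom (atlas a) x -> dom (atlas b) x ->
    met a x = Jac_transition a b x *m met b x *m (Jac_transition a b x)^T }.

(* A smooth field of endomorphisms of the tangent bundle. *)
Record endo_field n (M : manifold n) := EndoField {
  endo :> idx M -> M -> 'M[R]_n;
  endo_smooth : forall a, smooth_on (img (atlas a)) (in_chart a (endo a));
  endo_tensor : forall a b x, dom (atlas a) x -> dom (atlas b) x ->
    endo a x *m Jac_transition a b x = Jac_transition a b x *m endo b x }.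

Definition parallel n (M : manifold n) (g : metric M) (E : endo_field M) :
    Prop :=
  forall a, parallel_on (img (atlas a)) (in_chart a (g a)) (in_chart a (E a)).

(* Integrability of J is implied by its being parallel. *)
Definition kaehler n (M : manifold n) (g : metric M) (J : endo_field M) :
    Prop :=
  [/\ forall a x, dom (atlas a) x -> J a x *m J a x = - 1%:M,
      forall a x, dom (atlas a) x -> forall u v,
        ip (g a x) (u *m J a x) (v *m J a x) = ip (g a x) u v &
      parallel g J].

Definition const_hol_curvature n (M : manifold n) (g : metric M)
    (J : endo_field M) (k : R) : Prop :=
  forall a x, dom (atlas a) x -> forall v, v != 0 ->
    sectional (in_chart a (g a)) (atlas a x) v (v *m J a x) = k.

Definition complex_space_form n (M : manifold n) (g : metric M)
    (J : endo_field M) (c : R) : Prop :=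
  kaehler g J /\ const_hol_curvature g J (4 * c).

(* "Euclidean space": every point has an open neighbourhood which a smooth
   injective map sends isometrically onto an open subset of R^n with its
   standard metric.  Space forms are not assumed complete or simply connected
   (an open ball or a torus of C^m is one), so this is a local notion. *)
Definition euclidean n (M : manifold n) (g : metric M) : Prop :=
  forall q : M, exists (U : set M) (phi : M -> 'rV[R]_n),
  [/\ open U /\ U q,
      forall a, smooth_on (atlas a @` (dom (atlas a) `&` U)) (in_chart a phi),
      forall x y, U x -> U y -> phi x = phi y -> x = y,
      open (phi @` U) &
      forall a x, dom (atlas a) x -> U x ->
        forall u v : 'rV[R]_n,
          let d := 'J (in_chart a phi) (atlas a x) in
          ip 1%:M (u *m d) (v *m d) = ip (g a x) u v].

End Manifolds.

Section Submanifolds.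
Context {R : realType} {n N : nat} {M : @manifold R n} {Mb : @manifold R N}.

Definition local_map (f : M -> Mb) (a : idx M) (b : idx Mb) :
    'rV[R]_n -> 'rV[R]_N :=
  atlas b \o f \o point_at (atlas a).

Definition local_dom (f : M -> Mb) (a : idx M) (b : idx Mb) :
    set 'rV[R]_n :=
  atlas a @` (dom (atlas a) `&` f @^-1` dom (atlas b)).

(* The differential of f at x; its row space is T_x(M), viewed in the tangent
   space of Mb at f x. *)
Definition dmap (f : M -> Mb) (a : idx M) (b : idx Mb) (x : M) :
    'M[R]_(n, N) :=
  'J (local_map f a b) (atlas a x).

Definition at_charts (f : M -> Mb) (P : idx M -> idx Mb -> M -> Prop) : Prop :=
  forall a b x, dom (atlas a) x -> dom (atlas b) (f x) -> P a b x.

Definition immersion (f : M -> Mb) : Prop :=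
  [/\ continuous f,
      forall a b, smooth_on (local_dom f a b) (local_map f a b) &
      at_charts f (fun a b x => row_free (dmap f a b x))].

Definition induced_metric (f : M -> Mb) (gb : metric Mb) (g : metric M) :
    Prop :=
  at_charts f (fun a b x => forall u v : 'rV[R]_n,
    ip (g a x) u v = ip (gb b (f x)) (u *m dmap f a b x) (v *m dmap f a b x)).

(* A smooth vector field along f; [field b x] consists of the components of
   the vector at f x in the chart b of Mb. *)
Record field_along (f : M -> Mb) := FieldAlong {
  field :> idx Mb -> M -> 'rV[R]_N;
  field_smooth : forall a b,
    smooth_on (local_dom f a b) (in_chart a (field b));
  field_tensor : forall b b' x, dom (atlas b) (f x) -> dom (atlas b') (f x) ->
    field b' x = field b x *m Jac_transition b b' (f x) }.

(* The maximal complex subspace H_x(M) of T_x(M). *)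
Definition hol_tangent (f : M -> Mb) (J : endo_field Mb) a b x : 'M[R]_N :=
  (dmap f a b x *m J b (f x) :&: dmap f a b x)%MS.

(* Complex dimension of a J-invariant subspace. *)
Definition dimC m (H : 'M[R]_(m, N)) : nat := (\rank H)./2.

Definition CR_maximal (f : M -> Mb) (J : endo_field Mb) : Prop :=
  at_charts f (fun a b x =>
    (dimC (hol_tangent f J a b x))%:R = (n%:R - 1) / 2 :> R).

Definition distinguished (f : M -> Mb) (gb : metric Mb) (J : endo_field Mb)
    (xi : field_along f) : Prop :=
  at_charts f (fun a b x =>
    [/\ ip (gb b (f x)) (xi b x) (xi b x) = 1,
        forall u : 'rV[R]_n, ip (gb b (f x)) (u *m dmap f a b x) (xi b x) = 0 &
        (dmap f a b x *m J b (f x) <= dmap f a b x + xi b x)%MS]).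

(* The covariant derivative of xi along f in the direction of the tangent
   vector u of M at x; its normal part is D_u xi. *)
Definition ambient_derivative (f : M -> Mb) (gb : metric Mb)
    (xi : field_along f) a b x (u : 'rV[R]_n) : 'rV[R]_N :=
  nabla_along (in_chart b (gb b)) (local_map f a b) u (in_chart a (xi b))
    (atlas a x).

Definition normal_derivative (f : M -> Mb) (gb : metric Mb)
    (xi : field_along f) a b x (u : 'rV[R]_n) : 'rV[R]_N :=
  normal_part (gb b (f x)) (dmap f a b x) (ambient_derivative gb xi a b x u).

Definition normal_parallel (f : M -> Mb) (gb : metric Mb)
    (xi : field_along f) : Prop :=
  at_charts f (fun a b x => forall u, normal_derivative gb xi a b x u = 0).

Definition shape_operator (f : M -> Mb) (gb : metric Mb) (xi : field_along f)
    (A : endo_field M) : Prop :=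
  at_charts f (fun a b x => forall u : 'rV[R]_n,
    ambient_derivative gb xi a b x u =
    - (u *m A a x *m dmap f a b x) + normal_derivative gb xi a b x u).

End Submanifolds.

(* Main.v *)
Require Import Defs.
From HB Require Import structures.
From mathcomp Require Import all_boot all_order all_algebra.
From mathcomp Require Import all_classical all_reals all_analysis.
From mathcomp Require Import ring lra.

Set Implicit Arguments.
Unset Strict Implicit.
Unset Printing Implicit Defensive.

Import Order.TTheory GRing.Theory Num.Theory.
Import numFieldNormedType.Exports.
Local Open Scope classical_set_scope.
Local Open Scope ring_scope.

(** The theorem has a pointwise algebraic half, which gives [c = 0], and an
    analytic half, which turns a flat metric into Euclidean charts.

    Vanishing of [c].  Since [D xi = 0], the derivative of [xi] along [M] is
    [- A], and differentiating once more gives, by the Gauss formula, the Codazzi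
    equation: the tangential part of [Rbar(X, Y) xi] is
    [(nabla_Y A) X - (nabla_X A) Y], hence zero ([codazzi]).  On the other hand,
    polarising the holomorphic sectional curvature of a Kaehler curvature tensor
    gives [<Rbar(u, Ju) w, Jw> = - 2 c |u|^2 |w|^2] for [w] orthogonal to [u] and
    [Ju] ([complex_lines_bisectional]).  Maximality of the CR dimension provides
    [Y <> 0] with [Y] and [JY] tangent, because [n >= 3]
    ([holomorphic_direction]), and makes [J xi] tangent, because an
    odd-dimensional [T_x(M)] is not [J]-invariant ([J_normal_tangent]).  Taking
    [u = Y] and [w = xi], and pairing [Rbar(Y, JY) xi] with the tangent vector
    [J xi], yields [0 = - 2 c |Y|^2].

    From [c = 0] to Euclidean charts.  The same polarisation shows that the whole
    curvature tensor vanishes ([holomorphically_flat]).  An isometry onto an open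
    subset of Euclidean space is a system of [N] functions [phi] whose
    differentials are parallel, so the pair [(phi, d phi)] solves a linear total
    differential system [D_u om = om *m theta_u]; its integrability condition is
    the vanishing of curvature and torsion.  Such a system is solved along the
    rays from a point ([flat_system_solvable]): the value [om y] is the end value
    of a linear ordinary differential equation, which Picard iteration solves, and
    flatness makes the first-order variation of [om] the prescribed one.  Starting
    from an orthonormal coframe, given by a Cholesky factor of the metric, the
    coframe stays orthonormal because its defect solves a linear equation with
    zero initial value ([developing_map]).  The inverse function theorem, in the
    form of a perturbation of the identity, then makes [phi] injective with open
    image ([smooth_local_inverse]).

    As linear maps act on the right, a connection is handled as a matrix [C_u]
    depending linearly on a direction [u], with
    [nabla_u w = D_u w + w *m C_u], and its curvature is
    [D_u C_v - D_v C_u + C_v *m C_u - C_u *m C_v]. *)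

(** * Differential calculus of matrix-valued functions *)

Section MxNorm.
Context {R : realType}.

Lemma mx_norm_le m n (A : 'M[R]_(m, n)) (e : R) : 0 <= e ->
  (forall i j, `|A i j| <= e) -> `|A| <= e.
Proof.
move=> e0 h; rewrite [leLHS]/Num.Def.normr/= mx_normrE.
by apply: bigmax_le => // -[i j] _; exact: h.
Qed.

Lemma entry_le_norm m n (A : 'M[R]_(m, n)) i j : `|A i j| <= `|A|.
Proof.
by rewrite [leRHS]/Num.Def.normr/= mx_normrE; exact: (le_bigmax _ _ (i, j)).
Qed.

Lemma mulmx_norm_le m n p (A : 'M[R]_(m, n)) (B : 'M[R]_(n, p)) :
  `|A *m B| <= n%:R * (`|A| * `|B|).
Proof.
apply: mx_norm_le; first by rewrite !mulr_ge0.
move=> i j; rewrite mxE (le_trans (ler_norm_sum _ _ _))//.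
apply: le_trans (_ : \sum_(k < n) `|A| * `|B| <= _).
  by apply: ler_sum => k _; rewrite normrM ler_pM// entry_le_norm.
by rewrite sumr_const card_ord mulr_natl.
Qed.

Lemma continuous_mx (T : topologicalType) m n (F : T -> 'M[R]_(m, n)) (y : T) :
  (forall i j, {for y, continuous (fun z => F z i j)}) -> {for y, continuous F}.
Proof.
move=> h; apply/cvgrPdist_le => e e0.
have : \forall z \near y, forall i, forall j, `|F y i j - F z i j| <= e.
  apply: filter_forall => i; apply: filter_forall => j.
  by have /cvgrPdist_le := h i j; exact.
apply: filterS => z hz; apply: mx_norm_le; first exact: ltW.
by move=> i j; rewrite !mxE; exact: hz.
Qed.

Lemma continuous_mulmx (T : topologicalType) m n p (A : T -> 'M[R]_(m, n))
    (B : T -> 'M[R]_(n, p)) (y : T) :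
  {for y, continuous A} -> {for y, continuous B} ->
  {for y, continuous (fun z => A z *m B z)}.
Proof.
move=> cA cB; apply: continuous_mx => i j.
have entry a b (F : T -> 'M[R]_(a, b)) k l : {for y, continuous F} ->
    {for y, continuous (fun z => F z k l)}.
  by move=> cF; have := continuous_comp cF (@coord_continuous R a b k l (F y)).
have -> : (fun z => (A z *m B z) i j) = fun z => \sum_k A z i k * B z k j.
  by apply/funext => z; rewrite mxE.
elim: (index_enum _) => [|k r IH].
  have -> : (fun z => \sum_(k <- [::]) A z i k * B z k j) = cst 0.
    by apply/funext => z; rewrite big_nil.
  exact: cst_continuous.
have -> : (fun z => \sum_(l <- k :: r) A z i l * B z l j) =
    fun z => A z i k * B z k j + \sum_(l <- r) A z i l * B z l j.
  by apply/funext => z; rewrite big_cons.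
exact: continuousD (continuousM (entry _ _ _ _ _ cA) (entry _ _ _ _ _ cB)) IH.
Qed.

End MxNorm.

Section MxDerive.
Context {R : realType} {V : normedModType R}.

Lemma is_derive_mx m n (F : V -> 'M[R]_(m, n)) x v (dF : 'M[R]_(m, n)) :
  (forall i j, is_derive x v (fun y => F y i j) (dF i j)) ->
  is_derive x v F dF.
Proof.
move=> h; have dx : derivable F x v by apply/derivable_mxP => i j; have [] := h i j.
apply: DeriveDef => //; rewrite derive_mx//; apply/matrixP => i j.
by rewrite mxE; have [_ ->] := h i j.
Qed.

Lemma is_derive_entry m n (F : V -> 'M[R]_(m, n)) x v (dF : 'M[R]_(m, n)) i j :
  is_derive x v F dF -> is_derive x v (fun y => F y i j) (dF i j).
Proof.
move=> [dx <-]; rewrite derive_mx// mxE.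
by apply: derivableP; exact: ((derivable_mxP _ _ _).1 dx).
Qed.

Lemma is_derive_bigsum (I : Type) (r : seq I) (W : normedModType R)
    (F : I -> V -> W) x v (dF : I -> W) :
  (forall i, is_derive x v (F i) (dF i)) ->
  is_derive x v (fun y => \sum_(i <- r) F i y) (\sum_(i <- r) dF i).
Proof.
move=> h; elim: r => [|i r IH].
  rewrite big_nil (_ : (fun y => _) = cst 0); first exact: is_derive_cst.
  by apply/funext => y; rewrite big_nil.
rewrite big_cons (_ : (fun y => _) = (F i \+ fun y => \sum_(i <- r) F i y)).
  exact: is_deriveD.
by apply/funext => y; rewrite big_cons.
Qed.

Lemma is_derive_mulmx m n p (A : V -> 'M[R]_(m, n)) (B : V -> 'M[R]_(n, p))
    x v dA dB :
  is_derive x v A dA -> is_derive x v B dB ->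
  is_derive x v (fun y => A y *m B y) (dA *m B x + A x *m dB).
Proof.
move=> hA hB; apply: is_derive_mx => i j.
rewrite (_ : (fun y => _) = (fun y => \sum_k A y i k * B y k j)); last first.
  by apply/funext => y; rewrite mxE.
apply: is_derive_eq.
  apply: is_derive_bigsum => k.
  by apply: is_deriveM; exact: is_derive_entry.
rewrite !mxE -big_split/=; apply: eq_bigr => k _.
by rewrite addrC /GRing.scale/= [_ * dA i k]mulrC.
Qed.

Lemma is_derive_trmx m n (A : V -> 'M[R]_(m, n)) x v dA :
  is_derive x v A dA -> is_derive x v (fun y => (A y)^T) dA^T.
Proof.
move=> hA; apply: is_derive_mx => i j.
rewrite mxE (_ : (fun y => _) = (fun y => A y j i)); first exact: is_derive_entry.
by apply/funext => y; rewrite mxE.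
Qed.

Lemma is_derive_scalemx m n (f : V -> R)
    (F : V -> 'M[R]_(m, n)) x v df dF :
  is_derive x v f df -> is_derive x v F dF ->
  is_derive x v (fun y => f y *: F y) (df *: F x + f x *: dF).
Proof.
move=> hf hF; apply: is_derive_mx => i j.
under eq_fun do rewrite mxE.
apply: is_derive_eq; first by apply: is_deriveM; exact: is_derive_entry.
by rewrite !mxE /GRing.scale/=; ring.
Qed.

Lemma differentiable_mx m n (F : V -> 'M[R]_(m, n)) x :
  (forall i j, differentiable (fun y => F y i j) x) -> differentiable F x.
Proof.
move=> h.
rewrite (_ : F = \sum_(i < m) \sum_(j < n) (fun y => F y i j *: delta_mx i j)).
  apply: differentiable_sum => i; apply: differentiable_sum => j.
  exact: differentiableZl.
apply/funext => y; rewrite fct_sumE [LHS]matrix_sum_delta; apply: eq_bigr => i _.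
by rewrite fct_sumE.
Qed.

End MxDerive.

Lemma is_derive_comp (R : realType) (U V W : normedModType R)
    (F : U -> V) (g : V -> W) y u :
  differentiable F y -> differentiable g (F y) ->
  is_derive y u (fun z => g (F z)) ('D_('D_u F y) g (F y)).
Proof.
move=> dF dg.
have dgF : differentiable (g \o F) y by exact: differentiable_comp.
apply: DeriveDef; first exact: diff_derivable.
by rewrite -/(g \o F) !deriveE// diff_comp.
Qed.

Section DiffEstimate.
Context {R : realType} {V W : normedModType R}.

(** The little-o definition of the differential in epsilon form: it lets
    differentiability be derived from explicit inequalities. *)
Lemma differentiable_estimate (f : V -> W) (df : {linear V -> W}) (x : V) :
  continuous df ->
  (forall e : R, 0 < e ->
     \forall h \near (0 : V), `|f (h + x) - f x - df h| <= e * `|h|) ->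
  is_diff x f df.
Proof.
move=> cdf est.
have dxf : f \o shift x = cst (f x) + df +o_ 0 id.
  apply/eqaddoP => e e0; have := est e e0; apply: filterS => h.
  by rewrite /= opprD addrA.
apply: DiffDef; last exact: diff_unique.
have e := diff_unique cdf dxf.
by apply/diff_locallyP; rewrite !e; split=> //; rewrite e.
Qed.

Lemma diff_estimate (f : V -> W) (x : V) (e : R) : differentiable f x -> 0 < e ->
  \forall h \near (0 : V), `|f (h + x) - f x - 'd f x h| <= e * `|h|.
Proof.
move=> /diff_locally + e0.
move=> /eqaddoP  /(_ e e0); apply: filterS => h /=.
by rewrite opprD addrA.
Qed.

Lemma near_eq_differentiable (f g : V -> W) (x : V) :
  {near x, f =1 g} -> differentiable f x -> differentiable g x.
Proof.
move=> fg df; have fgx : f x = g x by exact: nbhs_singleton fg.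
suff : is_diff x g ('d f x) by move=> ?; exact: ex_diff.
apply: differentiable_estimate; first exact: diff_continuous.
move=> e e0; near=> h.
rewrite -fgx -(_ : f (h + x) = g (h + x)).
  by near: h; exact: diff_estimate.
near: h; have : \forall z \near x, f z = g z by [].
by move=> /nbhs0P; apply: filterS => h; rewrite addrC.
Unshelve. all: by end_near. Qed.

End DiffEstimate.

Section Segments.
Context {R : realType} {V W : normedModType R}.

Lemma is_derive_line (f : V -> W) (y v : V) (t : R) :
  differentiable f (y + t *: v) ->
  is_derive t 1 (fun s => f (y + s *: v)) ('D_v f (y + t *: v)).
Proof.
move=> df.
have dl : is_diff t (fun s : R => y + s *: v) (0 + ( *:%R^~ v)).
  exact: is_diffD.
have := @is_derive_comp R _ _ _ (fun s : R => y + s *: v) f t 1.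
have -> : 'D_1 (fun s : R => y + s *: v) t = v.
  by rewrite deriveE ?diff_val; [rewrite /= add0r scale1r|exact: ex_diff].
by apply=> //; exact: ex_diff.
Qed.

End Segments.

Lemma segment_MVT (R : realType) (V : normedModType R) (f : V -> R) (y v : V) :
  (forall t : R, 0 <= t <= 1 -> differentiable f (y + t *: v)) ->
  exists2 s : R, 0 < s < 1 & f (y + v) - f y = 'D_v f (y + s *: v).
Proof.
move=> df.
have [||c] := @MVT R (fun s => f (y + s *: v)) (fun s => 'D_v f (y + s *: v)) 0 1 ltr01.
- move=> x; rewrite in_itv/= => /andP[x0 x1]; apply: is_derive_line; apply: df.
  by rewrite !ltW.
- apply: derivable_within_continuous => x; rewrite in_itv/= => x01.
  by have [] := @is_derive_line R V R f y v x (df x x01).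
rewrite in_itv/= => c01; rewrite scale1r scale0r addr0 subr0 mulr1 => ->.
by exists c.
Qed.
(** * Functions of class C^k *)

Section Ck.
Context {R : realType} {n : nat}.
Implicit Types (V : set 'rV[R]_n) (f g : 'rV[R]_n -> R).

Lemma near_eq_on (T : Type) V (f g : 'rV[R]_n -> T) y : open V ->
  (forall y, V y -> f y = g y) -> V y -> {near y, f =1 g}.
Proof. by move=> oV fg Vy; near=> z; apply: fg; near: z; exact: open_nbhs_nbhs.
Unshelve. all: by end_near. Qed.

Lemma Ck_cont k V f y : C_k k V f -> V y -> {for y, continuous f}.
Proof.
case: k => [|k] /=; first by apply.
by move=> [df _] Vy; apply: differentiable_continuous; exact: df.
Qed.

Lemma Ck_weaken k V f : C_k k.+1 V f -> C_k k V f.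
Proof.
elim: k f => [|k IH] f; first by move=> h y; exact: (Ck_cont h).
by move=> [df h]; split=> // i; apply: IH.
Qed.

Lemma Ck_sub k V U f : U `<=` V -> C_k k V f -> C_k k U f.
Proof.
move=> UV; elim: k f => [|k IH] f /=; first by move=> h y /UV; exact: h.
by move=> [df h]; split=> [y /UV|i]; [exact: df|exact: IH].
Qed.

Lemma Ck_ext k V f g : open V -> (forall y, V y -> f y = g y) ->
  C_k k V f -> C_k k V g.
Proof.
move=> oV; elim: k f g => [|k IH] f g fg.
  move=> h y Vy; have gf : forall y, V y -> g y = f y by move=> z /fg.
  have e : g z @[z --> y] --> f y.
    exact: cvg_trans (near_eq_cvg (near_eq_on oV fg Vy)) (h y Vy).
  by rewrite -(gf y Vy) in e.
move=> [df h]; split=> [y Vy|i].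
  by apply: near_eq_differentiable (df y Vy); exact: near_eq_on Vy.
apply: IH (h i) => y Vy; apply: near_eq_derive.
exact: near_eq_on Vy.
Qed.

Lemma Ck_cst k V (a : R) : C_k k V (fun=> a).
Proof.
elim: k a => [|k IH] a /=; first by move=> y _; exact: cst_continuous.
split=> [y _|i]; first exact: differentiable_cst.
rewrite (_ : partial i _ = cst 0); first exact: IH.
by apply/funext => y; exact: derive_cst.
Qed.

Lemma Ck_coord k V (j : 'I_n) : C_k k V (fun y => y 0 j).
Proof.
have dc y : differentiable (fun y : 'rV[R]_n => y 0 j) y by exact: differentiable_coord.
case: k => [|k]; first by move=> y _; exact: differentiable_continuous.
split=> [y _|i]; first by [].
rewrite (_ : partial i _ = cst ((delta_mx 0 i : 'rV[R]_n) 0 j)); first exact: Ck_cst.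
apply/funext => y; have := @is_derive_id R 'rV[R]_n y (delta_mx 0 i).
by move=> /(is_derive_entry 0 j) [_ <-].
Qed.

Lemma CkD k V f g : open V -> C_k k V f -> C_k k V g -> C_k k V (fun y => f y + g y).
Proof.
move=> oV; elim: k f g => [|k IH] f g.
  by move=> hf hg y Vy; exact: (continuousD (hf y Vy) (hg y Vy)).
move=> [df hf] [dg hg]; split=> [y Vy|i].
  by apply: differentiableD; [exact: df|exact: dg].
apply: Ck_ext (IH _ _ (hf i) (hg i)) => // y Vy.
by rewrite /partial deriveD//; apply: diff_derivable; [exact: df|exact: dg].
Qed.

Lemma CkM k V f g : open V -> C_k k V f -> C_k k V g -> C_k k V (fun y => f y * g y).
Proof.
move=> oV; elim: k f g => [|k IH] f g.
  by move=> hf hg y Vy; exact: (continuousM (hf y Vy) (hg y Vy)).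
move=> hf hg; have [df hf'] := hf; have [dg hg'] := hg; split=> [y Vy|i].
  by apply: differentiableM; [exact: df|exact: dg].
apply: Ck_ext (CkD oV (IH _ _ (Ck_weaken hf) (hg' i))
                      (IH _ _ (Ck_weaken hg) (hf' i))) => // y Vy.
by rewrite /partial deriveM//; apply: diff_derivable; [exact: df|exact: dg].
Qed.

(** The derivative of [1 / f] is [- f' / f^2], of class C^k by the product rule
    and the induction hypothesis applied to [1 / f] itself. *)
Lemma CkV k V f : open V -> (forall y, V y -> f y != 0) ->
  C_k k V f -> C_k k V (fun y => (f y)^-1).
Proof.
move=> oV f0; elim: k f f0 => [|k IH] f f0.
  by move=> hf y Vy; exact: (continuousV (f0 y Vy) (hf y Vy)).
move=> hf; have [df hf'] := hf; split=> [y Vy|i].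
  by apply: differentiableV; [exact: df|exact: f0].
have hV := IH f f0 (Ck_weaken hf).
have := CkM oV (CkM oV (Ck_cst k V (-1)) (CkM oV hV hV)) (hf' i).
apply: Ck_ext => // y Vy.
rewrite /partial deriveV; [|exact: f0|by apply: diff_derivable; exact: df].
by rewrite /GRing.scale/= expr2 invfM mulN1r.
Qed.

Lemma Ck_sum k V (I : Type) (r : seq I) (P : pred I) (F : I -> 'rV[R]_n -> R) :
  open V -> (forall i, C_k k V (F i)) -> C_k k V (fun y => \sum_(i <- r | P i) F i y).
Proof.
move=> oV h; elim: r => [|i r IH].
  by under eq_fun do rewrite big_nil; exact: Ck_cst.
under eq_fun do rewrite big_cons; case: (P i) => //; exact: CkD.
Qed.

Lemma Ck_prod k V (I : Type) (r : seq I) (P : pred I) (F : I -> 'rV[R]_n -> R) :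
  open V -> (forall i, C_k k V (F i)) -> C_k k V (fun y => \prod_(i <- r | P i) F i y).
Proof.
move=> oV h; elim: r => [|i r IH].
  by under eq_fun do rewrite big_nil; exact: Ck_cst.
under eq_fun do rewrite big_cons; case: (P i) => //; exact: CkM.
Qed.

End Ck.

Lemma directional_partial (R : realType) n (f : 'rV[R]_n -> R) y (v : 'rV[R]_n) :
  differentiable f y -> 'D_v f y = \sum_i v 0 i * partial i f y.
Proof.
move=> df; rewrite deriveE// [v in LHS]row_sum_delta linear_sum; apply: eq_bigr => i _.
by rewrite linearZ -deriveE.
Qed.

Lemma Ck_comp (R : realType) m n k (V : set 'rV[R]_m) (U : set 'rV[R]_n)
    (T : 'rV[R]_m -> 'rV[R]_n) (f : 'rV[R]_n -> R) :
  open V -> (forall y, V y -> U (T y)) -> (forall j, C_k k V (fun y => T y 0 j)) ->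
  C_k k U f -> C_k k V (fun y => f (T y)).
Proof.
move=> oV VU; elim: k f => [|k IH] f hT hf.
  move=> y Vy; apply: continuous_comp; last exact/hf/VU.
  by apply: continuous_mx => i j; rewrite ord1; exact: hT.
have dT y : V y -> differentiable T y.
  move=> Vy; apply: differentiable_mx => i j; rewrite ord1.
  by have [h _] := hT j; exact: h.
have [df hf'] := hf; split=> [y Vy|i].
  by apply: differentiable_comp; [exact: dT|exact/df/VU].
have := @Ck_sum _ _ k V _ (index_enum 'I_n) predT
  (fun j y => partial i (fun y => T y 0 j) y * partial j f (T y)) oV.
have h j : C_k k V (fun y => partial i (fun y => T y 0 j) y * partial j f (T y)).
  apply: CkM => //; first by have [_] := hT j; exact.
  by apply: IH; [move=> l; exact/Ck_weaken/hT|exact: hf'].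
move=> /(_ h); apply: Ck_ext => // y Vy.
rewrite /partial; have [_ ->] := is_derive_comp (delta_mx 0 i) (dT y Vy) (df _ (VU _ Vy)).
rewrite directional_partial; last exact/df/VU.
apply: eq_bigr => j _; congr (_ * _).
have : is_derive y (delta_mx 0 i) T ('D_(delta_mx 0 i) T y).
  by apply: derivableP; exact/diff_derivable/dT.
by move=> /(is_derive_entry 0 j) [_ ->].
Qed.
(** * Smooth matrix-valued functions *)

Section Smooth.
Context {R : realType} {d : nat} (V : set 'rV[R]_d) (oV : open V).

Lemma smooth_differentiable m n (F : 'rV[R]_d -> 'M[R]_(m, n)) y :
  smooth_on V F -> V y -> differentiable F y.
Proof.
move=> sF Vy; apply: differentiable_mx => i j.
by have [h _] := sF i j 1%N; exact: h.
Qed.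

Lemma smooth_is_derive m n (F : 'rV[R]_d -> 'M[R]_(m, n)) y u :
  smooth_on V F -> V y -> is_derive y u F ('D_u F y).
Proof.
by move=> sF Vy; apply: derivableP; exact/diff_derivable/(smooth_differentiable sF Vy).
Qed.

Lemma smooth_sub m n (U : set 'rV[R]_d) (F : 'rV[R]_d -> 'M[R]_(m, n)) :
  U `<=` V -> smooth_on V F -> smooth_on U F.
Proof. by move=> UV sF i j k; exact: Ck_sub (sF i j k). Qed.

Lemma smooth_ext m n (F G : 'rV[R]_d -> 'M[R]_(m, n)) :
  (forall y, V y -> F y = G y) -> smooth_on V F -> smooth_on V G.
Proof. by move=> FG sF i j k; apply: Ck_ext (sF i j k) => // y Vy; rewrite FG. Qed.

Lemma smooth_cst m n (A : 'M[R]_(m, n)) : smooth_on V (fun=> A).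
Proof. by move=> i j k; exact: Ck_cst. Qed.

Lemma smooth_id : smooth_on V id.
Proof. by move=> i j k; rewrite ord1; exact: Ck_coord. Qed.

Lemma smoothD m n (F G : 'rV[R]_d -> 'M[R]_(m, n)) :
  smooth_on V F -> smooth_on V G -> smooth_on V (fun y => F y + G y).
Proof. by move=> sF sG i j k; under eq_fun do rewrite mxE; exact: CkD. Qed.

Lemma smooth_mul m n p (F : 'rV[R]_d -> 'M[R]_(m, n)) (G : 'rV[R]_d -> 'M[R]_(n, p)) :
  smooth_on V F -> smooth_on V G -> smooth_on V (fun y => F y *m G y).
Proof.
move=> sF sG i j k; under eq_fun do rewrite mxE.
by apply: Ck_sum => // l; exact: CkM.
Qed.

Lemma smooth_scale (f : 'rV[R]_d -> R) m n (F : 'rV[R]_d -> 'M[R]_(m, n)) :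
  (forall k, C_k k V f) -> smooth_on V F -> smooth_on V (fun y => f y *: F y).
Proof. by move=> sf sF i j k; under eq_fun do rewrite mxE; exact: CkM. Qed.

Lemma smoothN m n (F : 'rV[R]_d -> 'M[R]_(m, n)) :
  smooth_on V F -> smooth_on V (fun y => - F y).
Proof.
move=> sF; under eq_fun do rewrite -scaleN1r.
by apply: smooth_scale => // k; exact: Ck_cst.
Qed.

Lemma smooth_sum m n (I : Type) (r : seq I) (F : I -> 'rV[R]_d -> 'M[R]_(m, n)) :
  (forall i, smooth_on V (F i)) -> smooth_on V (fun y => \sum_(i <- r) F i y).
Proof.
move=> sF; elim: r => [|i r IH].
  by under eq_fun do rewrite big_nil; exact: smooth_cst.
by under eq_fun do rewrite big_cons; exact: smoothD.
Qed.

Lemma smooth_tr m n (F : 'rV[R]_d -> 'M[R]_(m, n)) :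
  smooth_on V F -> smooth_on V (fun y => (F y)^T).
Proof. by move=> sF i j k; under eq_fun do rewrite mxE; exact: sF. Qed.

Lemma Ck_det n (F : 'rV[R]_d -> 'M[R]_n) k :
  smooth_on V F -> C_k k V (fun y => \det (F y)).
Proof.
move=> sF; rewrite /determinant; apply: Ck_sum => // s.
apply: CkM => //; first exact: Ck_cst.
by apply: Ck_prod => // i; exact: sF.
Qed.

(** Cramer's rule expresses the inverse through determinants. *)
Lemma smooth_invmx n (F : 'rV[R]_d -> 'M[R]_n) :
  smooth_on V F -> (forall y, V y -> F y \in unitmx) ->
  smooth_on V (fun y => invmx (F y)).
Proof.
move=> sF uF.
apply: (@smooth_ext _ _ (fun y => (\det (F y))^-1 *: \adj (F y))).
  by move=> y Vy; rewrite /invmx uF.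
apply: smooth_scale => [k|i j k].
  by apply: CkV => // [y /uF|]; [rewrite unitmxE unitfE|exact: Ck_det].
under eq_fun do rewrite mxE.
apply: CkM => //; first exact: Ck_cst.
apply: (Ck_det (F := fun y => row' j (col' i (F y)))) => i' j' k'.
by under eq_fun do rewrite !mxE; exact: sF.
Qed.

Lemma Ck_derive (f : 'rV[R]_d -> R) w k : (forall k, C_k k V f) -> C_k k V ('D_w f).
Proof.
move=> sf; apply: (@Ck_ext _ _ _ _ (fun y => \sum_l w 0 l * partial l f y)) => //.
  by move=> z Vz; rewrite directional_partial//; have [h _] := sf 1%N; exact: h.
apply: Ck_sum => // l; apply: CkM => //; first exact: Ck_cst.
by have [_ h] := sf k.+1; exact: h.
Qed.

Lemma derive_entry m n (F : 'rV[R]_d -> 'M[R]_(m, n)) y u i j :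
  smooth_on V F -> V y -> 'D_u F y i j = 'D_u (fun z => F z i j) y.
Proof.
by move=> sF Vy; have /(is_derive_entry i j)[_ ->] := smooth_is_derive u sF Vy.
Qed.

Lemma smooth_derive m n (F : 'rV[R]_d -> 'M[R]_(m, n)) u :
  smooth_on V F -> smooth_on V ('D_u F).
Proof.
move=> sF i j k.
apply: (@Ck_ext _ _ _ _ ('D_u (fun z => F z i j))) => //.
  by move=> y Vy; rewrite derive_entry.
by apply: Ck_derive => k'; exact: sF.
Qed.

Lemma smooth_jacobian n (F : 'rV[R]_d -> 'rV[R]_n) :
  smooth_on V F -> smooth_on V (fun y => 'J F y).
Proof.
move=> sF i j k.
apply: (@Ck_ext _ _ _ _ (fun y => 'D_(delta_mx 0 i) F y 0 j)) => //.
  move=> y Vy; rewrite deriveEjacobian; last exact: (smooth_differentiable sF Vy).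
  by rewrite -rowE mxE.
exact: smooth_derive.
Qed.

End Smooth.

Lemma smooth_comp (R : realType) d e m n (V : set 'rV[R]_d) (U : set 'rV[R]_e)
    (T : 'rV[R]_d -> 'rV[R]_e) (F : 'rV[R]_e -> 'M[R]_(m, n)) :
  open V -> (forall y, V y -> U (T y)) -> smooth_on V T -> smooth_on U F ->
  smooth_on V (fun y => F (T y)).
Proof.
move=> oV VU sT sF i j k.
apply: (@Ck_comp _ _ _ k V U T (fun z => F z i j)) oV VU _ (sF i j k).
by move=> l; exact: sT.
Qed.

(** * Symmetry of second derivatives *)

Section Schwarz.
Context {R : realType} {d : nat} (V : set 'rV[R]_d) (oV : open V).

(** Two applications of the mean value theorem, first to
    [z |-> f (z + u) - f z] in the direction [v], then to [D_v f] in the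
    direction [u]. *)
Lemma second_difference (f : 'rV[R]_d -> R) y u v :
  (forall z, V z -> differentiable f z) ->
  (forall z, V z -> differentiable ('D_v f) z) ->
  (forall s t : R, 0 <= s <= 1 -> 0 <= t <= 1 -> V (y + s *: u + t *: v)) ->
  exists s t : R, [/\ 0 <= s <= 1, 0 <= t <= 1 &
    f (y + u + v) - f (y + u) - (f (y + v) - f y)
      = 'D_u ('D_v f) (y + s *: u + t *: v)].
Proof.
move=> df ddf inV.
have I0 : 0 <= (0 : R) <= 1 by rewrite lexx ler01.
have I1 : 0 <= (1 : R) <= 1 by rewrite lexx ler01.
have isD z : V z -> V (z + u) ->
    is_derive z v (fun z => f (z + u) - f z) ('D_v f (z + u) - 'D_v f z).
  move=> Vz Vzu; apply: is_deriveB; last exact/derivableP/diff_derivable/df.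
  have := @is_derive_comp R _ _ _ (fun z => z + u) f z v.
  have isu : is_derive z v (fun z : 'rV[R]_d => z + u) v.
    by apply: is_derive_eq (addr0 v); apply: is_deriveD.
  have [_ ->] := isu; apply; last exact: df.
  by apply: differentiableD.
have [|t t01 e1] := @segment_MVT R _ (fun z => f (z + u) - f z) y v.
  move=> t t01; apply: differentiableB; last first.
    by apply: df; have := inV 0 t I0 t01; rewrite scale0r addr0.
  apply: (@differentiable_comp _ _ _ _ (fun z => z + u) f).
    by apply: differentiableD.
  by apply: df; have := inV 1 t I1 t01; rewrite scale1r addrAC.
have t01' : 0 <= t <= 1 by case/andP: t01 => ? ?; rewrite !ltW.
have [|s s01 e2] := @segment_MVT R _ ('D_v f) (y + t *: v) u.
  by move=> s s01; apply: ddf; rewrite addrAC; exact: inV.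
exists s, t; split; [by case/andP: s01 => ? ?; rewrite !ltW|exact: t01'|].
have [||_ e3] := isD (y + t *: v).
- by have := inV 0 t I0 t01'; rewrite scale0r addr0.
- by have := inV 1 t I1 t01'; rewrite scale1r addrAC.
rewrite [y + s *: u + _]addrAC -e2 -e3 -e1 [y + v + u]addrAC.
ring.
Qed.

(** The second difference of [f] along [r u] and [r v] is symmetric in [u] and
    [v], and divided by [r^2] it tends to either mixed derivative. *)
Lemma derive_swap_scalar (f : 'rV[R]_d -> R) y u v : (forall k, C_k k V f) ->
  V y -> 'D_u ('D_v f) y = 'D_v ('D_u f) y.
Proof.
move=> sf Vy.
have sD w k : C_k k V ('D_w f) by exact: Ck_derive.
have sDD w w' k : C_k k V ('D_w ('D_w' f)).
  by apply: Ck_derive => // k'; exact: Ck_derive.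
have dD w z : V z -> differentiable ('D_w f) z.
  by move=> Vz; have [h _] := sD w 1%N; exact: h.
have df z : V z -> differentiable f z by move=> Vz; have [h _] := sf 1%N; exact: h.
(* the region on which a mean value point may fall *)
have ball_close (A : 'rV[R]_d -> R) (e : R) : 0 < e -> {for y, continuous A} ->
    exists2 r : R, 0 < r & forall z, `|z - y| < r -> V z /\ `|A z - A y| <= e.
  move=> e0 cA; have /cvgrPdist_le/(_ e e0) hA := cA.
  have hV : \forall z \near y, V z by exact: open_nbhs_nbhs.
  have /nbhs_ballP[r /= r0 hr] : \forall z \near y, V z /\ `|A y - A z| <= e.
    by near=> z; split; near: z.
  exists r => // z zr; rewrite [`|A z - _|]distrC; apply: hr.
  by rewrite -ball_normE /= distrC.
have H u' v' (e : R) : 0 < e -> exists2 r0 : R, 0 < r0 & forall r : R, 0 < r -> r <= r0 ->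
    `|(f (y + r *: u' + r *: v') - f (y + r *: u') - (f (y + r *: v') - f y)) / (r * r)
      - 'D_u' ('D_v' f) y| <= e.
  move=> e0; set N := `|u'| + `|v'| + 1.
  have N0 : 0 < N by rewrite ltr_wpDl// addr_ge0.
  have cA : {for y, continuous ('D_u' ('D_v' f))}.
    apply: differentiable_continuous.
    by have [h _] := sDD u' v' 1%N; exact: h.
  have [r0 r00 hr0] := ball_close _ _ e0 cA; exists (r0 / N) => [|r r1 rr0].
    by rewrite divr_gt0.
  have near_y s t : 0 <= s <= 1 -> 0 <= t <= 1 ->
      `|y + s *: (r *: u') + t *: (r *: v') - y| < r0.
    move=> /andP[s0 s1] /andP[t0 t1].
    have rN : r * N <= r0 by rewrite -ler_pdivlMr.
    apply: lt_le_trans rN.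
    rewrite -[y + _ + _]addrA [y + _]addrC addrK (le_lt_trans (ler_normD _ _))//.
    rewrite !normrZ !ger0_norm ?(ltW r1)//.
    have := normr_ge0 u'; have := normr_ge0 v'; rewrite /N => a0 b0.
    have h1 : s * (r * `|u'|) <= r * `|u'| by rewrite ler_piMl// mulr_ge0// ltW.
    have h2 : t * (r * `|v'|) <= r * `|v'| by rewrite ler_piMl// mulr_ge0// ltW.
    by rewrite !mulrDr mulr1; lra.
  have inV s t : 0 <= s <= 1 -> 0 <= t <= 1 -> V (y + s *: (r *: u') + t *: (r *: v')).
    by move=> s01 t01; have [] := hr0 _ (near_y s t s01 t01).
  have [a [b [a01 b01 ->]]] := second_difference df (dD _) inV.
  have [Vz hz] := hr0 _ (near_y a b a01 b01).
  set z := _ + _ in Vz hz *.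
  have -> : 'D_(r *: u') ('D_(r *: v') f) z = (r * r) * 'D_u' ('D_v' f) z.
    rewrite deriveE ?linearZ -?deriveE; [|exact: dD..].
    have -> : 'D_u' ('D_(r *: v') f) z = 'D_u' (r *: 'D_v' f) z.
      apply: near_eq_derive; apply: (near_eq_on oV _ Vz) => x Vx.
      by rewrite deriveE ?linearZ -?deriveE//; exact: df.
    rewrite deriveZ; last exact/diff_derivable/dD.
    by rewrite [LHS]scalerA.
  by rewrite mulrAC mulfV ?mul1r// mulf_neq0// gt_eqF.
apply/eqP; rewrite -subr_eq0 -normr_le0; apply/ler_addgt0Pl => e e0.
rewrite addr0.
have e2 : 0 < e / 2 by lra.
have [r1 r10 h1] := H u v _ e2.
have [r2 r20 h2] := H v u _ e2.
have r0 : 0 < Num.min r1 r2 by rewrite lt_min r10.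
have {}h1 : _ <= _ := h1 _ r0 ltac:(by rewrite ge_min lexx).
have {}h2 : _ <= _ := h2 _ r0 ltac:(by rewrite ge_min lexx orbT).
move: h1 h2; set r := Num.min _ _; rewrite [y + r *: v + r *: u]addrAC.
set a := f _; set b := f _; set c := f _; set g := f _.
have -> : a - c - (b - g) = a - b - (c - g) by ring.
set q := _ / _ => h1 h2; rewrite (splitr e).
move: h1 h2; move: ('D_u _ _) ('D_v _ _) q => A B q h1 h2.
have -> : A - B = (q - B) - (q - A) by ring.
by apply: le_trans (ler_normB _ _) _; rewrite addrC lerD.
Unshelve. all: by end_near. Qed.

Lemma derive_swap m n (F : 'rV[R]_d -> 'M[R]_(m, n)) y u v : smooth_on V F ->
  V y -> 'D_u ('D_v F) y = 'D_v ('D_u F) y.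
Proof.
move=> sF Vy; apply/matrixP => i j.
have e w w' : 'D_w ('D_w' F) y i j = 'D_w ('D_w' (fun z => F z i j)) y.
  rewrite (@derive_entry _ _ V)//; last exact: smooth_derive.
  apply: near_eq_derive; apply: (near_eq_on oV _ Vy) => z Vz.
  exact: (derive_entry (V := V)).
apply: etrans (e u v) (etrans _ (esym (e v u))).
by apply: (derive_swap_scalar _ _ _ Vy) => k; exact: sF.
Qed.

End Schwarz.

(** * Identities between matrices *)

Local Opaque derive.

(** Sums of products of non-commuting matrices are compared by applying an
    arbitrary linear form, after which the products are scalars and commutative
    ring reasoning applies. *)
Lemma mx_additive_eq (R : realType) m n (A B : 'M[R]_(m, n)) :
  (forall e : 'M[R]_(m, n) -> R, {morph e : X Y / X + Y} -> {morph e : X / - X} ->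
     e 0 = 0 -> (forall a X, e (a *: X) = a * e X) -> e A = e B) -> A = B.
Proof.
move=> h; apply/matrixP => i j; apply: (h (fun X => X i j)).
- by move=> X Y; rewrite mxE.
- by move=> X; rewrite mxE.
- by rewrite mxE.
- by move=> a X; rewrite mxE.
Qed.

Ltac mx_expand := rewrite ?(mulmxDl, mulmxDr, mulNmx, mulmxN, mulmxA).

Ltac mx_ring := mx_expand;
  let e := fresh "e" in let eD := fresh "eD" in let eN := fresh "eN" in
  let e0 := fresh "e0" in let eZ := fresh "eZ" in
  apply: mx_additive_eq => e eD eN e0 eZ; rewrite ?(eD, eN, e0, eZ); ring.

(** Proves goals of the form [A = B -> C = D]. *)
Ltac mx_lra :=
  let e := fresh "e" in let eD := fresh "eD" in let eN := fresh "eN" in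
  let e0 := fresh "e0" in let eZ := fresh "eZ" in let h := fresh "h" in
  move=> h; apply: mx_additive_eq => e eD eN e0 eZ; move: h => /(congr1 e);
  rewrite ?(eD, eN, e0, eZ); lra.

(** Matrix form of the first Bianchi identity.  The variable [Duv] stands for
    [D_u C_v]; the hypotheses express that [w *m C_v] is symmetric in [v] and [w],
    and so are its derivatives. *)
Lemma bianchi_algebra (R : realType) m n (u v w : 'M[R]_(m, n))
    (Cu Cv Cw Duv Dvu Dvw Dwv Dwu Duw : 'M[R]_n) :
  w *m Duv = v *m Duw -> u *m Dvw = w *m Dvu -> v *m Dwu = u *m Dwv ->
  w *m Cv = v *m Cw -> w *m Cu = u *m Cw -> u *m Cv = v *m Cu ->
  w *m (Duv - Dvu + Cv *m Cu - Cu *m Cv) + u *m (Dvw - Dwv + Cw *m Cv - Cv *m Cw)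
  + v *m (Dwu - Duw + Cu *m Cw - Cw *m Cu) = 0.
Proof.
move=> h1 h2 h3 h4 h5 h6; rewrite !(mulmxDr, mulmxN, mulmxA) h1 h2 h3 h4 h5 h6.
mx_ring.
Qed.

(** [Dg C] is the derivative of a metric [G] that is parallel for [C]; the
    hypothesis is the symmetry of the second derivatives of [G], computed by
    differentiating [Dg]. *)
Lemma metric_skew_algebra (R : realType) n (G Cu Cv Duv Dvu : 'M[R]_n) :
  G^T = G -> let Dg C := C *m G + (C *m G)^T in
  Duv *m G + Cv *m Dg Cu + (Duv *m G + Cv *m Dg Cu)^T =
  Dvu *m G + Cu *m Dg Cv + (Dvu *m G + Cu *m Dg Cv)^T ->
  (Duv - Dvu + Cv *m Cu - Cu *m Cv) *m G =
  - ((Duv - Dvu + Cv *m Cu - Cu *m Cv) *m G)^T.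
Proof.
move=> symG Dg; rewrite /Dg.
have trD (A B : 'M[R]_n) : (A + B)^T = A^T + B^T by rewrite linearD.
have trN (A : 'M[R]_n) : (- A)^T = - A^T by rewrite linearN.
rewrite !(mulmxDr, mulmxDl, mulNmx, trD, trN) !(trmx_mul, trmxK, trD) symG.
rewrite !mulmxA.
mx_lra.
Qed.

(** As in [metric_skew_algebra], with a parallel endomorphism [J] in the place of
    the metric. *)
Lemma commutator_algebra (R : realType) n (J Cu Cv Duv Dvu : 'M[R]_n) :
  let Dj C := C *m J - J *m C in
  Duv *m J + Cv *m Dj Cu - (Dj Cu *m Cv + J *m Duv) =
  Dvu *m J + Cu *m Dj Cv - (Dj Cv *m Cu + J *m Dvu) ->
  (Duv - Dvu + Cv *m Cu - Cu *m Cv) *m J = J *m (Duv - Dvu + Cv *m Cu - Cu *m Cv).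
Proof.
move=> Dj; rewrite /Dj !(mulmxDr, mulmxDl, mulNmx, mulmxN, mulmxA).
mx_lra.
Qed.

(** * The Levi-Civita connection and its curvature *)

Section Connection.
Context {R : realType} {n : nat}.
Implicit Types (G : 'rV[R]_n -> 'M[R]_n) (u v w y : 'rV[R]_n).

(** The connection matrix [C_u]: row [j], column [k] holds
    [Gamma^k_{ij} u^i], so that [nabla_u w = D_u w + w *m C_u]. *)
Definition conn_form G u y : 'M[R]_n :=
  \matrix_(j, k) \sum_i christoffel G y i j k * u 0 i.

Lemma GammaE G y u w : Gamma G y u w = w *m conn_form G u y.
Proof.
apply/rowP => k; rewrite !mxE exchange_big/=; apply: eq_bigr => j _.
by rewrite mxE mulr_sumr; apply: eq_bigr => i _; rewrite mulrC.
Qed.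

Lemma conn_form_linear G y u v (a : R) :
  conn_form G (a *: u + v) y = a *: conn_form G u y + conn_form G v y.
Proof.
apply/matrixP => j k; rewrite !mxE mulr_sumr -big_split/=; apply: eq_bigr => i _.
by rewrite !mxE; ring.
Qed.

Lemma conn_form_sum G y u : conn_form G u y = \sum_i u 0 i *: conn_form G (delta_mx 0 i) y.
Proof.
apply/matrixP => j k; rewrite mxE summxE; apply: eq_bigr => i _.
rewrite !mxE (bigD1 i)//= big1 ?addr0 => [|l li].
  by rewrite mxE !eqxx /=; ring.
by rewrite mxE (negbTE li) andbF mulr0.
Qed.

Lemma nablaE G (X Y : 'rV[R]_n -> 'rV[R]_n) y :
  nabla G X Y y = 'D_(X y) Y y + Y y *m conn_form G (X y) y.
Proof. by rewrite /nabla GammaE. Qed.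

End Connection.

Section Riemannian.
Context {R : realType} {n : nat} {V : set 'rV[R]_n} {G : 'rV[R]_n -> 'M[R]_n}.
Hypothesis oV : open V.
Hypothesis sG : smooth_on V G.
Hypothesis symG : forall y, V y -> (G y)^T = G y.
Hypothesis posG : forall y, V y -> forall v, v != 0 -> 0 < ip (G y) v v.
Implicit Types (u v w y : 'rV[R]_n).

Lemma posdef_unitmx y : V y -> G y \in unitmx.
Proof.
move=> Vy; rewrite -row_free_unit -kermx_eq0; apply/rowV0P => v /sub_kermxP vG.
apply/eqP/negPn/negP => v0; have := posG Vy v0.
by rewrite /ip vG mul0mx mxE ltxx.
Qed.

Lemma Ck_christoffel i j k l : C_k l V (fun y => christoffel G y i j k).
Proof.
apply: CkM => //; first exact: Ck_cst.
apply: Ck_sum => // p; apply: CkM => //; first exact: (smooth_invmx oV sG posdef_unitmx).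
have h a b c : C_k l V (partial a (fun z => G z b c)) by have [_] := sG b c l.+1; exact.
apply: CkD => //; first exact: CkD.
apply: (@Ck_ext _ _ _ _ (fun y => -1 * partial p (fun z => G z i j) y)) => //.
  by move=> y _; rewrite mulN1r.
by apply: CkM => //; exact: Ck_cst.
Qed.

Lemma smooth_conn_form u : smooth_on V (conn_form G u).
Proof.
move=> j k l; under eq_fun do rewrite mxE.
by apply: Ck_sum => // i; apply: CkM => //; [exact: Ck_christoffel|exact: Ck_cst].
Qed.

Lemma partial_sym i j l y : V y ->
  partial l (fun z => G z i j) y = partial l (fun z => G z j i) y.
Proof.
move=> Vy; apply: near_eq_derive; apply: (near_eq_on oV _ Vy) => z Vz.
by rewrite -{1}(symG Vz) mxE.
Qed.

Lemma torsion_free u v y : V y -> u *m conn_form G v y = v *m conn_form G u y.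
Proof.
move=> Vy; apply/rowP => k; rewrite !mxE.
have E (a b : 'rV[R]_n) : \sum_j a 0 j * conn_form G b y j k =
    \sum_j \sum_i christoffel G y i j k * (a 0 j * b 0 i).
  by apply: eq_bigr => j _; rewrite mxE mulr_sumr; apply: eq_bigr => i _; ring.
rewrite !E exchange_big; apply: eq_bigr => i _; apply: eq_bigr => j _.
rewrite [v 0 i * _]mulrC; congr (_ * _); rewrite /christoffel; congr (_ * _).
apply: eq_bigr => l _; congr (_ * _); rewrite [partial l (fun z => G z j i) y]partial_sym//.
ring.
Qed.

(** Lowering an index gives the Christoffel symbols of the first kind, in which
    the inverse metric no longer appears. *)
Lemma conn_form_lower u y j l : V y ->
  (conn_form G u y *m G y) j l = \sum_i u 0 i * (2^-1 *
    (partial i (fun z => G z j l) y + partial j (fun z => G z i l) y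
     - partial l (fun z => G z i j) y)).
Proof.
move=> Vy; rewrite mxE.
transitivity (\sum_i \sum_k (u 0 i * christoffel G y i j k * G y k l)).
  rewrite exchange_big/=; apply: eq_bigr => k _; rewrite mxE mulr_suml.
  by apply: eq_bigr => i _; ring.
apply: eq_bigr => i _; rewrite /christoffel.
set P := fun p => partial i (fun z => G z j p) y + partial j (fun z => G z i p) y
     - partial p (fun z => G z i j) y.
transitivity (\sum_k \sum_p u 0 i * (2^-1 * (P p * (invmx (G y) k p * G y k l)))).
  apply: eq_bigr => k _; rewrite mulr_sumr mulr_sumr mulr_suml; apply: eq_bigr => p _.
  by rewrite -/(P p); ring.
rewrite exchange_big/=.
have E p : \sum_k invmx (G y) k p * G y k l = (p == l)%:R.
  have : (invmx (G y) *m G y)^T p l = (1%:M : 'M[R]_n)^T p l.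
    by rewrite mulVmx// posdef_unitmx.
  rewrite trmx1 mxE [in RHS]mxE => <-.
  have -> : (invmx (G y) *m G y) l p = ((G y)^T *m (invmx (G y))) l p.
    by rewrite symG// mulVmx ?mulmxV// posdef_unitmx.
  by rewrite mxE; apply: eq_bigr => k _; rewrite mxE mulrC.
transitivity (\sum_p u 0 i * (2^-1 * (P p * (p == l)%:R))).
  by apply: eq_bigr => p _; rewrite -E !mulr_sumr.
rewrite (bigD1 l)//= eqxx mulr1 big1 ?addr0// => p /negbTE ->.
by rewrite !mulr0.
Qed.

(** In the sum of a Christoffel symbol of the first kind and its transpose, the
    last two of the three derivatives of the metric cancel. *)
Lemma metric_compatible u y : V y ->
  'D_u G y = conn_form G u y *m G y + (conn_form G u y *m G y)^T.
Proof.
move=> Vy; apply/matrixP => j l.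
rewrite (derive_entry (V := V))// directional_partial; last first.
  by have [h _] := sG j l 1%N; exact: h.
rewrite [RHS]mxE [X in _ = _ + X]mxE !conn_form_lower// -big_split; apply: eq_bigr => i _ /=.
by rewrite -mulrDr (partial_sym l j)//; congr (_ * _); lra.
Qed.

(** The matrix of [w |-> R(u, v) w] acting on row vectors. *)
Definition curv_form u v y : 'M[R]_n :=
  'D_u (conn_form G v) y - 'D_v (conn_form G u) y
  + conn_form G v y *m conn_form G u y - conn_form G u y *m conn_form G v y.

Lemma curvatureE y u v w : V y -> curvature G y u v w = w *m curv_form u v y.
Proof.
move=> Vy.
have E a b c : nabla G (cst a) (nabla G (cst b) (cst c)) y =
    c *m ('D_a (conn_form G b) y + conn_form G b y *m conn_form G a y).
  rewrite nablaE/=.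
  have -> : nabla G (cst b) (cst c) = fun z => c *m conn_form G b z.
    by apply/funext => z; rewrite nablaE derive_cst add0r.
  have h := is_derive_mulmx (is_derive_cst c y a)
    (smooth_is_derive a (smooth_conn_form b) Vy).
  by have [_ ->] := h; rewrite mul0mx add0r mulmxDr mulmxA.
by rewrite /curvature !E -mulmxBr; congr (_ *m _); mx_ring.
Qed.

Lemma curv_form_skew u v y : curv_form v u y = - curv_form u v y.
Proof. by rewrite /curv_form; mx_ring. Qed.

Lemma curv_form_bianchi u v w y : V y ->
  w *m curv_form u v y + u *m curv_form v w y + v *m curv_form w u y = 0.
Proof.
move=> Vy.
have E a b c : a *m 'D_b (conn_form G c) y = c *m 'D_b (conn_form G a) y.
  have h (x z : 'rV[R]_n) := is_derive_mulmx (is_derive_cst x y b)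
    (smooth_is_derive b (smooth_conn_form z) Vy).
  have [_] := h a c; have [_] := h c a; rewrite !mul0mx !add0r => <- <-.
  by apply: near_eq_derive; apply: (near_eq_on oV _ Vy) => z Vz; exact: torsion_free.
apply: bianchi_algebra; [exact: E|exact: E|exact: E|..]; exact: torsion_free.
Qed.

(** Compare the two mixed second derivatives of the metric, which is parallel. *)
Lemma curv_form_metric_skew u v y : V y -> curv_form u v y *m G y = - (curv_form u v y *m G y)^T.
Proof.
move=> Vy.
have dC a b := smooth_is_derive a (smooth_conn_form b) Vy.
have dG a := smooth_is_derive a sG Vy.
have E a b : 'D_a ('D_b G) y =
    'D_a (conn_form G b) y *m G y + conn_form G b y *m 'D_a G y
    + ('D_a (conn_form G b) y *m G y + conn_form G b y *m 'D_a G y)^T.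
  have -> : 'D_a ('D_b G) y = 'D_a (fun z => conn_form G b z *m G z + (conn_form G b z *m G z)^T) y.
    by apply: near_eq_derive; apply: (near_eq_on oV _ Vy) => z Vz; exact: metric_compatible.
  have h := is_derive_mulmx (dC a b) (dG a).
  by have [_ ->] := is_deriveD h (is_derive_trmx h).
have := derive_swap oV u v sG Vy; rewrite (E u v) (E v u).
rewrite (metric_compatible u Vy) (metric_compatible v Vy).
exact: metric_skew_algebra (symG Vy).
Qed.

Lemma parallel_derive (J : 'rV[R]_n -> 'M[R]_n) u y : smooth_on V J ->
  parallel_on V G J -> V y -> 'D_u J y = conn_form G u y *m J y - J y *m conn_form G u y.
Proof.
move=> sJ pJ Vy; apply/row_matrixP => i; rewrite !rowE; set w := delta_mx 0 i.
have := pJ (cst u) (cst w) (@smooth_cst _ _ _ _ _ _) (@smooth_cst _ _ _ _ _ _) y Vy.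
rewrite !nablaE/= derive_cst add0r.
have [_ ->] := is_derive_mulmx (is_derive_cst w y u) (smooth_is_derive u sJ Vy).
rewrite mul0mx add0r => /subr0_eq e.
by rewrite mulmxBr !mulmxA -e addrK.
Qed.

(** Compare the two mixed second derivatives of [J]. *)
Lemma curv_form_parallel (J : 'rV[R]_n -> 'M[R]_n) u v y : smooth_on V J ->
  parallel_on V G J -> V y -> curv_form u v y *m J y = J y *m curv_form u v y.
Proof.
move=> sJ pJ Vy.
have dC a b := smooth_is_derive a (smooth_conn_form b) Vy.
have dJ a := smooth_is_derive a sJ Vy.
have E a b : 'D_a ('D_b J) y =
    'D_a (conn_form G b) y *m J y + conn_form G b y *m 'D_a J y
    - ('D_a J y *m conn_form G b y + J y *m 'D_a (conn_form G b) y).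
  have -> : 'D_a ('D_b J) y = 'D_a (fun z => conn_form G b z *m J z - J z *m conn_form G b z) y.
    by apply: near_eq_derive; apply: (near_eq_on oV _ Vy) => z Vz; exact: parallel_derive.
  have h1 := is_derive_mulmx (dC a b) (dJ a).
  have h2 := is_derive_mulmx (dJ a) (dC a b).
  by have [_ ->] := is_deriveB h1 h2.
have := derive_swap oV u v sJ Vy; rewrite (E u v) (E v u).
rewrite (parallel_derive u sJ pJ Vy) (parallel_derive v sJ pJ Vy).
exact: commutator_algebra.
Qed.

End Riemannian.

(** * Kaehler curvature tensors *)

(** [B x y z w] is to be read as [<R(x, y) z, w>] and [q] as the metric; only
    additivity is used, so that the arguments may live in any abelian group. *)
Section KaehlerCurvature.
Context {R : realType} {E : zmodType}.
Variables (B : E -> E -> E -> E -> R) (J : E -> E) (q : E -> E -> R).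
Hypothesis BD1 : forall x x' y z w, B (x + x') y z w = B x y z w + B x' y z w.
Hypothesis BD2 : forall x x' y z w, B y (x + x') z w = B y x z w + B y x' z w.
Hypothesis BD3 : forall x x' y z w, B y z (x + x') w = B y z x w + B y z x' w.
Hypothesis B_skew12 : forall x y z w, B x y z w = - B y x z w.
Hypothesis B_skew34 : forall x y z w, B x y z w = - B x y w z.
Hypothesis B_cyclic : forall x y z w, B x y z w + B y z x w + B z x y w = 0.
Hypothesis B_inv : forall x y z w, B x y (J z) (J w) = B x y z w.
Hypothesis JD : forall x y, J (x + y) = J x + J y.
Hypothesis JJ : forall x, J (J x) = - x.

Hypothesis qD : forall x y z, q (x + y) z = q x z + q y z.
Hypothesis qC : forall x y, q x y = q y x.
Variable c : R.
Hypothesis B_hol : forall x, B x (J x) x (J x) = - (4 * c) * q x x ^+ 2.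

(** The octahedron argument: add the four cyclic identities. *)
Lemma kaehler_pair_sym z x y w : B z x y w = B y w z x.
Proof.
have h1 := B_cyclic x y z w; have h2 := B_cyclic y z w x.
have h3 := B_cyclic z w x y; have h4 := B_cyclic w x y z.
have e1 := B_skew34 x y w z; have e2 := B_skew34 y z w x.
have e3 := B_skew34 z w y x; have e4 := B_skew34 w x z y.
have e5 := B_skew12 z x y w; have e6 := B_skew34 x z y w.
have e7 := B_skew12 w y z x; have e8 := B_skew34 y w z x.
lra.
Qed.

Let BD4 x x' y z w : B y z w (x + x') = B y z w x + B y z w x'.
Proof. by rewrite B_skew34 BD3 !(B_skew34 y z w) opprD. Qed.

Let B0 y z w : B 0 y z w = 0.
Proof. by have := BD1 0 0 y z w; rewrite addr0 => h; lra. Qed.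

Let BN1 x y z w : B (- x) y z w = - B x y z w.
Proof. by have := BD1 x (- x) y z w; rewrite subrr B0 => h; lra. Qed.

Let BN2 x y z w : B y (- x) z w = - B y x z w.
Proof. by rewrite B_skew12 BN1 -B_skew12. Qed.

Let BN3 x y z w : B y z (- x) w = - B y z x w.
Proof. by rewrite kaehler_pair_sym BN1 -kaehler_pair_sym. Qed.

Let BN4 x y z w : B y z w (- x) = - B y z w x.
Proof. by rewrite B_skew34 BN3 -B_skew34. Qed.

Let JN x : J (- x) = - J x.
Proof.
have J0 : J 0 = 0 by apply: (addrI (J 0)); rewrite -JD !addr0.
by apply/eqP; rewrite -addr_eq0 -JD addNr J0.
Qed.

Lemma kaehler_J_swap34 x y z w : B x y w (J z) = B x y z (J w).
Proof. by rewrite -B_inv JJ BN4 -B_skew34. Qed.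

Lemma kaehler_J_swap12 x y z w : B y (J x) z w = B x (J y) z w.
Proof. by rewrite kaehler_pair_sym kaehler_J_swap34 kaehler_pair_sym. Qed.

(** The part of [B_hol] of bidegree (2, 2) in [u] and [w], obtained by adding its
    instances at [u + w] and [u - w]. *)
Lemma holomorphic_polarization u w :
  2 * B u (J u) w (J w) + 4 * B u (J w) u (J w) =
  - (4 * c) * (2 * (q u u * q w w) + 4 * q u w ^+ 2).
Proof.
have qDr x y z : q z (x + y) = q z x + q z y by rewrite qC qD !(qC _ z).
have q0 y : q 0 y = 0 by have := qD 0 0 y; rewrite addr0 => h; lra.
have qN x y : q (- x) y = - q x y.
  by have := qD x (- x) y; rewrite subrr q0 => h; lra.
have qNr x y : q y (- x) = - q y x by rewrite qC qN qC.
have hp := B_hol (u + w); have hm := B_hol (u - w).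
have hu := B_hol u; have hw := B_hol w.
rewrite !(JD, JN) !(BD1, BD2, BD3, BD4) !(BN1, BN2, BN3, BN4) in hp hm.
rewrite !(qD, qDr, qN, qNr) (qC w u) in hp hm.
have s1 := kaehler_J_swap12 u w; have s2 := fun x y => kaehler_J_swap34 x y u w.
rewrite !s1 !s2 (kaehler_pair_sym w (J w) u (J u)) in hp hm.
nra.
Qed.

(** The cyclic identity in [u], [J u], [w]. *)
Lemma sectional_J_sum u w :
  B u (J u) w (J w) = B u w u w + B u (J w) u (J w).
Proof.
have h := B_cyclic u (J u) w (J w).
have e1 : B (J u) w u (J w) = - B u (J w) u (J w).
  by rewrite B_skew12 kaehler_J_swap12.
have e2 : B w u (J u) (J w) = - B u w u w by rewrite B_inv B_skew12.
lra.
Qed.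

(** With [k u w := B u w u w], [holomorphic_polarization] and [sectional_J_sum]
    give [2 k(u, w) + 6 k(u, Jw) = - 8 c |u|^2 |w|^2]; replacing [w] by [J w]
    exchanges the two unknowns, so both equal [- c |u|^2 |w|^2], and their sum is
    [B u (J u) w (J w)]. *)
Lemma complex_lines_bisectional u w : q u w = 0 -> q u (J w) = 0 ->
  q (J w) (J w) = q w w ->
  B u (J u) w (J w) = - (2 * c) * (q u u * q w w).
Proof.
move=> uw uJw qJ; have h1 := holomorphic_polarization u w.
have := holomorphic_polarization u (J w).
have s1 := sectional_J_sum u w; have := sectional_J_sum u (J w).
rewrite JJ !BN4 !BN2 opprK (B_skew34 u _ (J w) w) opprK uw uJw qJ in h1 *.
lra.
Qed.

(** The same linear system with zero right-hand side kills the sectional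
    curvatures [B u w u w], without any orthogonality.  Polarising them in each
    variable makes [B] skew in its first and third arguments, and then the cyclic
    identity reads [3 B = 0]. *)
Lemma holomorphically_flat : c = 0 -> forall x y z w, B x y z w = 0.
Proof.
move=> c0.
have k0 u w : B u w u w = 0.
  have h1 := holomorphic_polarization u w.
  have := holomorphic_polarization u (J w).
  have s1 := sectional_J_sum u w; have := sectional_J_sum u (J w).
  rewrite JJ !BN4 !BN2 opprK (B_skew34 u _ (J w) w) opprK c0 in h1 *.
  lra.
have k1 u v w : B u v u w = 0.
  have := k0 u (v + w); rewrite BD2 !BD4 !k0 (kaehler_pair_sym u w u v).
  lra.
have k2 u v z w : B u v z w = - B z v u w.
  have := k1 (u + z) v w; rewrite BD1 !BD3 !k1; lra.
move=> x y z w; have := B_cyclic x y z w.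
have e1 : B y z x w = B x y z w by rewrite [RHS]k2 B_skew12.
have e2 : B z x y w = B x y z w by rewrite [LHS]k2 -B_skew12.
lra.
Qed.

End KaehlerCurvature.

(** * Complex space forms in a chart *)

Section InnerProduct.
Context {R : realType} {n : nat} (G : 'M[R]_n).

Lemma mx11_tr (X : 'M[R]_1) : X 0 0 = X^T 0 0.
Proof. by rewrite mxE. Qed.

Lemma ipDl u v w : ip G (u + v) w = ip G u w + ip G v w.
Proof. by rewrite /ip !mulmxDl mxE. Qed.

Lemma ipZl a u v : ip G (a *: u) v = a * ip G u v.
Proof. by rewrite /ip -!scalemxAl mxE. Qed.

Lemma ipNl u v : ip G (- u) v = - ip G u v.
Proof. by rewrite /ip !mulNmx mxE. Qed.

Lemma ipNr u v : ip G u (- v) = - ip G u v.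
Proof. by rewrite /ip linearN mulmxN mxE. Qed.

Lemma ip_mx m (P Q : 'M[R]_(m, n)) (u v : 'rV[R]_m) :
  ip G (u *m P) (v *m Q) = (u *m (P *m G *m Q^T) *m v^T) 0 0.
Proof. by rewrite /ip trmx_mul !mulmxA. Qed.

Lemma ip_skew (S : 'M[R]_n) u v : S *m G = - (S *m G)^T ->
  ip G (u *m S) v = - ip G (v *m S) u.
Proof.
move=> h; rewrite /ip -(mulmxA u) -(mulmxA v) [in LHS]h mulmxN mulNmx [LHS]mxE.
by congr (- _); rewrite [LHS]mx11_tr !trmx_mul !trmxK mulmxA.
Qed.

Lemma ip_sym : G^T = G -> forall u v, ip G u v = ip G v u.
Proof. by move=> h u v; rewrite /ip [LHS]mx11_tr !trmx_mul !trmxK h mulmxA. Qed.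

End InnerProduct.

Section SpaceForm.
Context {R : realType} {n : nat} {V : set 'rV[R]_n} {G J : 'rV[R]_n -> 'M[R]_n} {c : R}.
Hypothesis oV : open V.
Hypothesis sG : smooth_on V G.
Hypothesis symG : forall y, V y -> (G y)^T = G y.
Hypothesis posG : forall y, V y -> forall v, v != 0 -> 0 < ip (G y) v v.
Hypothesis sJ : smooth_on V J.
Hypothesis JJ : forall y, V y -> J y *m J y = - 1%:M.
Hypothesis isoJ : forall y, V y -> forall u v,
  ip (G y) (u *m J y) (v *m J y) = ip (G y) u v.
Hypothesis parJ : parallel_on V G J.
Hypothesis holG : forall y, V y -> forall v, v != 0 ->
  sectional G y v (v *m J y) = 4 * c.
Implicit Types (u v w y : 'rV[R]_n).

Lemma curv_form_additive u u' v y : V y -> @curv_form R n G (u + u') v y = @curv_form R n G u v y + @curv_form R n G u' v y.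
Proof.
move=> Vy; have sC a := smooth_conn_form oV sG posG a.
have connD z : conn_form G (u + u') z = conn_form G u z + conn_form G u' z.
  by have := conn_form_linear G z u u' 1; rewrite !scale1r.
have D1 : 'D_(u + u') (conn_form G v) y = 'D_u (conn_form G v) y + 'D_u' (conn_form G v) y.
  by have h := smooth_differentiable (sC v) Vy; rewrite !deriveE// linearD.
have D2 : 'D_v (conn_form G (u + u')) y = 'D_v (conn_form G u) y + 'D_v (conn_form G u') y.
  have [_ <-] := is_deriveD (smooth_is_derive v (sC u) Vy) (smooth_is_derive v (sC u') Vy).
  by congr ('D_v _ y); apply/funext => z; rewrite connD.
rewrite /curv_form D1 D2 connD.
by move: ('D__ _ _) ('D__ _ _) ('D__ _ _) ('D__ _ _) => *; mx_ring.
Qed.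

Definition curv4 y u v w z : R := ip (G y) (w *m @curv_form R n G u v y) z.

Section Point.
Variables (y : 'rV[R]_n) (Vy : V y).
Let B := curv4 y.
Let j x : 'rV[R]_n := x *m J y.
Let q := ip (G y).

Let BD1 x x' u v w : B (x + x') u v w = B x u v w + B x' u v w.
Proof. by rewrite /B /curv4 curv_form_additive// mulmxDr ipDl. Qed.

Let Bskew12 x u v w : B x u v w = - B u x v w.
Proof. by rewrite /B /curv4 curv_form_skew mulmxN ipNl. Qed.

Let BD2 x x' u v w : B u (x + x') v w = B u x v w + B u x' v w.
Proof. by rewrite Bskew12 BD1 !(Bskew12 u) opprD. Qed.

Let BD3 x x' u v w : B u v (x + x') w = B u v x w + B u v x' w.
Proof. by rewrite /B /curv4 mulmxDl ipDl. Qed.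

Let Bskew34 x u v w : B x u v w = - B x u w v.
Proof. by apply: ip_skew; exact: (curv_form_metric_skew oV sG symG posG). Qed.

Let Bcyc x u v w : B x u v w + B u v x w + B v x u w = 0.
Proof.
rewrite /B /curv4 -!ipDl (curv_form_bianchi oV sG symG posG)//.
by rewrite /ip !mul0mx mxE.
Qed.

Let Binv x u v w : B x u (j v) (j w) = B x u v w.
Proof.
rewrite /B /curv4 /j -mulmxA -(curv_form_parallel oV sG posG _ _ sJ parJ Vy) mulmxA.
exact: isoJ.
Qed.

Let jD x u : j (x + u) = j x + j u. Proof. exact: mulmxDl. Qed.

Let jj x : j (j x) = - x. Proof. by rewrite /j -mulmxA JJ// mulmxN mulmx1. Qed.

Let qD x u v : q (x + u) v = q x v + q u v. Proof. exact: ipDl. Qed.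

Let qC x u : q x u = q u x. Proof. by apply: ip_sym; exact: symG. Qed.

Lemma ip_J_orthogonal v : ip (G y) v (v *m J y) = 0.
Proof.
have := isoJ Vy v (v *m J y); rewrite -/(j v) -/(j (j v)) jj ipNr -/q qC.
by move=> h; lra.
Qed.

Let Bhol x : B x (j x) x (j x) = - (4 * c) * q x x ^+ 2.
Proof.
have [->|x0] := eqVneq x 0.
  by rewrite /B /curv4 /q /ip !mul0mx mxE expr2 !mulr0.
have := holG Vy x0; rewrite /sectional (curvatureE oV sG posG)// isoJ//.
rewrite ip_J_orthogonal expr0n subr0 -/(B x (j x) (j x) x) Bskew34 -/(q x x).
have q0 : q x x != 0 by rewrite gt_eqF// posG.
move=> /(canRL (mulfVK _)) h.
by rewrite expr2 mulNr -h ?mulf_neq0// opprK.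
Qed.

(** [complex_lines_bisectional] for the curvature of a complex space form. *)
Lemma orthogonal_bisectional u w : ip (G y) u w = 0 -> ip (G y) u (w *m J y) = 0 ->
  curv4 y u (u *m J y) w (w *m J y) = - (2 * c) * (ip (G y) u u * ip (G y) w w).
Proof.
move=> uw uJw.
have := complex_lines_bisectional BD1 BD2 BD3 Bskew12 Bskew34 Bcyc Binv jD jj qD qC Bhol uw uJw.
by apply; exact: isoJ.
Qed.

Lemma curv_form_zero u v : c = 0 -> @curv_form R n G u v y = 0.
Proof.
move=> c0.
have h := holomorphically_flat BD1 BD2 BD3 Bskew12 Bskew34 Bcyc Binv jD jj qD qC Bhol c0.
apply/row_matrixP => i; rewrite row0 rowE; apply/eqP/negPn/negP => r0.
by have := posG Vy r0; rewrite -/(curv4 y u v (delta_mx 0 i) _) [curv4 _ _ _ _ _]h ltxx.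
Qed.

End Point.

End SpaceForm.

(** * The Codazzi equation *)

(** The uniqueness half of Koszul's argument: a trilinear form symmetric in its
    first two arguments and skew in its last two vanishes. *)
Lemma koszul_unique (R : realType) n (X : 'rV[R]_n -> 'M[R]_n) :
  (forall u v, v *m X u = u *m X v) -> (forall u, (X u)^T = - X u) ->
  forall u, X u = 0.
Proof.
move=> symX skewX.
pose S (u v w : 'rV[R]_n) : R := (v *m X u *m w^T) 0 0.
have S1 u v w : S u v w = S v u w by rewrite /S symX.
have S2 u v w : S u v w = - S u w v.
  by rewrite /S [LHS]mx11_tr !trmx_mul trmxK skewX mulNmx mulmxN mulmxA mxE.
have S0 u v w : S u v w = 0.
  have := S1 u v w; have := S2 v u w; have := S1 v w u.
  have := S2 w v u; have := S1 w u v; have := S2 u w v; lra.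
move=> u; apply/matrixP => i j; rewrite mxE.
have := S0 u (delta_mx 0 i) (delta_mx 0 j); rewrite /S -rowE trmx_delta -colE.
by rewrite !mxE.
Qed.

(** [dAa] and [dAb] are the derivatives of a parallel endomorphism, [Ta] and [Tb]
    those of a tangent frame [D], and [P] pairs vectors with this frame; the
    hypotheses on [Ta] and [Tb] are the Gauss formula, the last one is
    torsion-freeness. *)
Lemma codazzi_algebra (R : realType) n N (a b : 'rV[R]_n) (A dAa dAb : 'M[R]_n)
    (D Ta Tb : 'M[R]_(n, N)) (P : 'M[R]_(N, n)) (g Ca Cb : 'M[R]_n) :
  D *m P = g -> Ta *m P = Ca *m g -> Tb *m P = Cb *m g ->
  dAa = Ca *m A - A *m Ca -> dAb = Cb *m A - A *m Cb -> a *m Cb = b *m Ca ->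
  (a *m dAb *m D + a *m A *m Tb - (b *m dAa *m D + b *m A *m Ta)) *m P = 0.
Proof.
move=> hD hTa hTb -> -> tf.
rewrite !(mulmxDl, mulNmx) -!(mulmxA _ D) -!(mulmxA _ Ta) -!(mulmxA _ Tb) hD hTa hTb.
rewrite !(mulmxDr, mulmxDl, mulmxN, mulNmx, mulmxA) tf.
mx_ring.
Qed.

Section Hypersurface.
Context {R : realType} {n N : nat} {W : set 'rV[R]_n} {V : set 'rV[R]_N}.
Context {F : 'rV[R]_n -> 'rV[R]_N} {Gb : 'rV[R]_N -> 'M[R]_N}.
Context {g A : 'rV[R]_n -> 'M[R]_n} {xi : 'rV[R]_n -> 'rV[R]_N}.
Implicit Types (a b u v w y : 'rV[R]_n).
Hypothesis oW : open W.
Hypothesis oV : open V.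
Hypothesis sF : smooth_on W F.
Hypothesis FV : forall y, W y -> V (F y).
Hypothesis sGb : smooth_on V Gb.
Hypothesis symGb : forall y : 'rV[R]_N, V y -> (Gb y)^T = Gb y.
Hypothesis posGb : forall y : 'rV[R]_N, V y -> forall v : 'rV[R]_N, v != 0 -> 0 < ip (Gb y) v v.
Hypothesis sg : smooth_on W g.
Hypothesis symg : forall y, W y -> (g y)^T = g y.
Hypothesis posg : forall y, W y -> forall v, v != 0 -> 0 < ip (g y) v v.
Hypothesis sA : smooth_on W A.
Hypothesis parA : forall u y, W y ->
  'D_u A y = conn_form g u y *m A y - A y *m conn_form g u y.
Hypothesis sxi : smooth_on W xi.

Let D y := 'J F y.

(** The connection of the ambient space pulled back by [F]. *)
Let theta u y := conn_form Gb (u *m D y) (F y).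

Hypothesis gE : forall y, W y -> g y = D y *m Gb (F y) *m (D y)^T.
Hypothesis dxi : forall u y, W y -> nabla_along Gb F u xi y = - (u *m A y *m D y).

Let dF y : W y -> differentiable F y.
Proof. exact: smooth_differentiable. Qed.

Let DE u y : W y -> 'D_u F y = u *m D y.
Proof. by move=> Wy; apply: deriveEjacobian; exact: dF. Qed.

Let sD : smooth_on W D. Proof. exact: smooth_jacobian. Qed.

Let is_dD u y (Wy : W y) := smooth_is_derive u sD Wy.
Let is_dA u y (Wy : W y) := smooth_is_derive u sA Wy.
Let is_dxi u y (Wy : W y) := smooth_is_derive u sxi Wy.

Let is_dcomp m1 m2 (H : 'rV[R]_N -> 'M[R]_(m1, m2)) u y :
  smooth_on V H -> W y ->
  is_derive y u (fun z => H (F z)) ('D_(u *m D y) H (F y)).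
Proof.
move=> sH Wy; have := @is_derive_comp R _ _ _ F H y u (dF Wy).
by rewrite DE//; apply; exact: (smooth_differentiable sH (FV Wy)).
Qed.

Let sconn (u : 'rV[R]_N) : smooth_on V (conn_form Gb u). Proof. exact: smooth_conn_form. Qed.

Lemma second_derivative_sym u v y : W y -> v *m 'D_u D y = u *m 'D_v D y.
Proof.
move=> Wy.
have E a b : b *m 'D_a D y = 'D_a ('D_b F) y.
  have [_] := is_derive_mulmx (is_derive_cst b y a) (is_dD a Wy).
  rewrite mul0mx add0r => <-.
  by apply: near_eq_derive; apply: (near_eq_on oW _ Wy) => z Wz; rewrite DE.
by rewrite (E u v) (E v u); exact: (derive_swap oW _ _ sF).
Qed.

Let is_dtheta a b y : W y -> is_derive y a (theta b)
  (conn_form Gb (b *m 'D_a D y) (F y) + 'D_(a *m D y) (conn_form Gb (b *m D y)) (F y)).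
Proof.
move=> Wy.
have h i : is_derive y a
    (fun z => (b *m D z) 0 i *: conn_form Gb (delta_mx 0 i) (F z))
    ((b *m 'D_a D y) 0 i *: conn_form Gb (delta_mx 0 i) (F y)
     + (b *m D y) 0 i *: 'D_(a *m D y) (conn_form Gb (delta_mx 0 i)) (F y)).
  apply: is_derive_scalemx; last exact: is_dcomp.
  apply: is_derive_entry.
  have := is_derive_mulmx (is_derive_cst b y a) (is_dD a Wy).
  by rewrite mul0mx add0r.
have := is_derive_bigsum (index_enum 'I_N) h; rewrite big_split/= -conn_form_sum.
have -> : (fun z => \sum_(i : 'I_N) (b *m D z) 0 i *: conn_form Gb (delta_mx 0 i) (F z)) = theta b.
  by apply/funext => z; rewrite -conn_form_sum.
suff <- : 'D_(a *m D y) (conn_form Gb (b *m D y)) (F y) = \sum_(i : 'I_N)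
    (b *m D y) 0 i *: 'D_(a *m D y) (conn_form Gb (delta_mx 0 i)) (F y) by [].
have h2 i : is_derive (F y) (a *m D y)
    (fun z => (b *m D y) 0 i *: conn_form Gb (delta_mx 0 i) z)
    ((b *m D y) 0 i *: 'D_(a *m D y) (conn_form Gb (delta_mx 0 i)) (F y)).
  apply: is_deriveZ; exact: (smooth_is_derive _ (sconn _) (FV Wy)).
have -> : conn_form Gb (b *m D y) =
    fun z => \sum_(i : 'I_N) (b *m D y) 0 i *: conn_form Gb (delta_mx 0 i) z.
  by apply/funext => z; rewrite -conn_form_sum.
by have [_] := is_derive_bigsum (index_enum 'I_N) h2.
Qed.

(** The derivative of [theta b] in the direction [a] consists of a term of the
    ambient curvature and of the connection matrix of a second derivative of [F];
    the latter is symmetric in [a] and [b] and cancels. *)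
Lemma pullback_curvature a b y : W y ->
  'D_a (theta b) y - 'D_b (theta a) y
  + theta b y *m theta a y - theta a y *m theta b y
  = @curv_form R N Gb (a *m D y) (b *m D y) (F y).
Proof.
move=> Wy; have [_ ->] := is_dtheta a b Wy; have [_ ->] := is_dtheta b a Wy.
rewrite (second_derivative_sym a b Wy) /curv_form /theta.
by move: ('D_(a *m D y) _ _) ('D_(b *m D y) _ _) => *; mx_ring.
Qed.

(** Row [j] of [Theta u] is the ambient covariant derivative of the tangent
    vector [F_j] in the direction [u]. *)
Let Theta u y := 'D_u D y + D y *m theta u y.

(** Both sides are symmetric in the direction and the differentiated vector, and
    each of them added to its transpose gives the derivative of the induced metric,
    so that [koszul_unique] applies to the difference. *)
Lemma gauss_formula u y : W y ->
  Theta u y *m Gb (F y) *m (D y)^T = conn_form g u y *m g y.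
Proof.
move=> Wy; apply/subr0_eq.
apply: (koszul_unique (X := fun u => Theta u y *m Gb (F y) *m (D y)^T - conn_form g u y *m g y)).
  move=> {}u v.
  have symT : v *m Theta u y = u *m Theta v y.
    rewrite /Theta !mulmxDr (second_derivative_sym u v Wy) !mulmxA.
    by rewrite (torsion_free oV symGb (v *m D y) (u *m D y) (FV Wy)).
  by rewrite !mulmxBr !mulmxA symT (torsion_free oW symg v u Wy).
move=> {}u.
have := metric_compatible oW sg symg posg u Wy.
have -> : 'D_u g y = 'D_u (fun z => D z *m Gb (F z) *m (D z)^T) y.
  by apply: near_eq_derive; apply: (near_eq_on oW _ Wy) => z Wz; exact: gE.
have h := is_derive_mulmx (is_derive_mulmx (is_dD u Wy) (is_dcomp u sGb Wy))
  (is_derive_trmx (is_dD u Wy)).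
have [_ ->] := h; rewrite (metric_compatible oV sGb symGb posGb _ (FV Wy)).
rewrite -/(theta u y) /Theta.
have trD m1 m2 (X Y : 'M[R]_(m1, m2)) : (X + Y)^T = X^T + Y^T by rewrite linearD.
have trN m1 m2 (X : 'M[R]_(m1, m2)) : (- X)^T = - X^T by rewrite linearN.
rewrite !(trmx_mul, trD, trN, trmxK, symGb (FV Wy), symg Wy).
rewrite !(mulmxDl, mulmxDr) !mulmxA.
by move: ('D_u D y) => dD; mx_lra.
Qed.

(** Exchanging the order of the derivatives of [xi] along [a] and [b] expresses
    the curvature by derivatives of [A] and by [Theta]; tangentially [Theta] is the
    connection of the induced metric, and what is left is
    [(nabla_b A) a - (nabla_a A) b]. *)
Lemma codazzi a b w y : W y ->
  ip (Gb (F y)) (xi y *m @curv_form R N Gb (a *m D y) (b *m D y) (F y)) (w *m D y) = 0.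
Proof.
move=> Wy.
have Dxi u z : W z -> 'D_u xi z = - (u *m A z *m D z + xi z *m theta u z).
  move=> Wz; have := dxi u Wz; rewrite /nabla_along GammaE -/(theta u z).
  by move=> /(canRL (addrK _)) ->; rewrite opprD.
have E u v : 'D_u ('D_v xi) y = - ((v *m 'D_u A y *m D y + v *m A y *m 'D_u D y)
    + ('D_u xi y *m theta v y + xi y *m 'D_u (theta v) y)).
  have -> : 'D_u ('D_v xi) y = 'D_u (fun z => - (v *m A z *m D z + xi z *m theta v z)) y.
    by apply: near_eq_derive; apply: (near_eq_on oW _ Wy) => z Wz; exact: Dxi.
  have h1 := is_derive_mulmx (is_derive_cst v y u) (is_dA u Wy).
  have h2 := is_derive_mulmx h1 (is_dD u Wy).
  have [ht1 _] := is_dtheta u v Wy.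
  have h3 := is_derive_mulmx (is_dxi u Wy) (derivableP ht1).
  have [_ ->] := is_deriveN (is_deriveD h2 h3).
  by rewrite mul0mx add0r.
have key : xi y *m @curv_form R N Gb (a *m D y) (b *m D y) (F y) =
    a *m 'D_b A y *m D y + a *m A y *m Theta b y
    - (b *m 'D_a A y *m D y + b *m A y *m Theta a y).
  rewrite -pullback_curvature// /Theta.
  have := derive_swap oW a b sxi Wy; rewrite (E a b) (E b a).
  rewrite (Dxi a _ Wy) (Dxi b _ Wy).
  move: ('D_a A y) ('D_b A y) ('D_a D y) ('D_b D y) ('D_a (theta b) y) ('D_b (theta a) y).
  move: (theta a y) (theta b y) => ta tb dA1 dA2 dD1 dD2 dt1 dt2.
  mx_expand; rewrite ?opprD ?opprK; mx_expand.
  mx_lra.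
suff h : xi y *m @curv_form R N Gb (a *m D y) (b *m D y) (F y) *m Gb (F y) *m (D y)^T = 0.
  by rewrite /ip trmx_mul !mulmxA h mul0mx mxE.
rewrite key -mulmxA; apply: (codazzi_algebra (g := g y) (Ca := conn_form g a y) (Cb := conn_form g b y)).
- by rewrite mulmxA gE.
- by rewrite mulmxA gauss_formula.
- by rewrite mulmxA gauss_formula.
- exact: parA.
- exact: parA.
- exact: (torsion_free oW symg a b Wy).
Qed.

End Hypersurface.

(** * Linear algebra of maximal CR dimension *)

(** The square of [det K] is [(-1)^n]. *)
Lemma complex_structure_even (R : realType) n (K : 'M[R]_n) :
  K *m K = - 1%:M -> ~~ odd n.
Proof.
move=> /(congr1 determinant); rewrite det_mulmx -scaleN1r detZ det1 mulr1 => e.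
apply/negP => on; have : 0 <= \det K * \det K by rewrite -expr2 sqr_ge0.
by rewrite e -signr_odd on expr1 oppr_ge0 ler10.
Qed.

Section MaximalCR.
Context {R : realType} {n N : nat}.
Variables (D : 'M[R]_(n, N)) (G J : 'M[R]_N) (xi : 'rV[R]_N).
Hypothesis n3 : (3 <= n)%N.
Hypothesis freeD : row_free D.
Hypothesis symG : G^T = G.
Hypothesis JJ : J *m J = - 1%:M.
Hypothesis isoJ : forall u v, ip G (u *m J) (v *m J) = ip G u v.
Hypothesis xi1 : ip G xi xi = 1.
Hypothesis xiD : forall u : 'rV[R]_n, ip G (u *m D) xi = 0.
Hypothesis subDJ : (D *m J <= D + xi)%MS.
Hypothesis dimH : ((\rank (D *m J :&: D)%MS)./2)%:R = (n%:R - 1) / 2 :> R.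

Let half_rank : ((\rank (D *m J :&: D)%MS)./2 * 2).+1 = n.
Proof.
apply/eqP; rewrite -(@eqr_nat R) -addn1 natrD natrM dimH; apply/eqP.
by field.
Qed.

(** By the dimension hypothesis [n] is odd. *)
Lemma tangent_not_complex : ~~ (D *m J <= D)%MS.
Proof.
apply/negP => /submxP[K DJ].
suff /complex_structure_even : K *m K = - 1%:M.
  by rewrite -half_rank /= muln2 odd_double.
apply: (row_free_inj freeD).
by rewrite -mulmxA -DJ mulmxA -DJ -mulmxA JJ mulmxN mulmx1 mulNmx mul1mx.
Qed.

(** Some tangent [t] has [J t = s + l xi] with [s] tangent and [l <> 0].  Applying
    [J] shows that [J xi] lies in the span of the tangent space and [xi], and its
    component along [xi] vanishes because [J] is skew. *)
Lemma J_normal_tangent : exists w : 'rV[R]_n, xi *m J = w *m D.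
Proof.
have /row_subPn[i] := tangent_not_complex; rewrite rowE mulmxA.
set t := delta_mx 0 i => tn.
have split_D (s : 'rV[R]_n) : exists s' : 'rV[R]_n, exists l : R, s *m D *m J = s' *m D + l *: xi.
  have /(submx_trans (submxMl s _))/sub_addsmxP[[s' l] /= e] := subDJ.
  exists s', (l 0 0); rewrite -mulmxA e; congr (_ + _).
  by rewrite [l in LHS]mx11_scalar mul_scalar_mx.
have [s [l e]] := split_D t.
have l0 : l != 0.
  by apply: contraNneq tn => l0; rewrite e l0 scale0r addr0 submxMl.
have [s' [l' e']] := split_D s.
have exJ : xi *m J = (- l^-1 *: (t + s')) *m D + (- (l' / l)) *: xi.
  have h : l *: xi = t *m D *m J - s *m D by rewrite e [s *m D + _]addrC addrK.
  have h2 : l *: (xi *m J) = - (t *m D) - (s' *m D + l' *: xi).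
    rewrite scalemxAl h mulmxBl e'; congr (_ - _).
    by rewrite -(mulmxA (t *m D)) JJ mulmxN mulmx1.
  apply: (scalerI l0); rewrite h2 scalerDr scalemxAl !scalerA !mulrN mulfV//.
  by rewrite mulrCA mulfV// mulr1 scaleN1r mulNmx mulmxDl scaleNr !opprD addrA.
have /eqP : ip G (xi *m J) xi = 0.
  have := isoJ xi (xi *m J); rewrite -mulmxA JJ mulmxN mulmx1 ipNr (ip_sym symG xi).
  by move=> h; lra.
rewrite exJ ipDl xiD add0r ipZl xi1 mulr1.
move=> /eqP mu0; exists (- l^-1 *: (t + s')).
by rewrite mu0 scale0r addr0.
Qed.

(** The holomorphic tangent space has real dimension at least [n - 1 >= 2]. *)
Lemma holomorphic_direction : exists u v : 'rV[R]_n,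
  u *m D != 0 /\ u *m D *m J = v *m D.
Proof.
have hr := half_rank; set H := (D *m J :&: D)%MS in hr *.
have H0 : H != 0.
  apply/negP => /eqP H0; move: n3.
  by rewrite -hr H0 mxrank0.
have rH : (nz_row H <= H)%MS by exact: nz_row_sub.
have /submxP[u eu] : (nz_row H <= D)%MS by exact: submx_trans rH (capmxSr _ _).
have /submxP[s es] : (nz_row H <= D *m J)%MS by exact: submx_trans rH (capmxSl _ _).
exists u, (- s); split; first by rewrite -eu nz_row_eq0.
by rewrite -eu es -!mulmxA JJ !mulmxN mulmx1 mulNmx.
Qed.

(** With [Y = u *m D] holomorphic and [J xi] tangent, the first hypothesis says
    that [K Y (J Y) xi (J xi)] is zero, the second that it is [- 2 c |Y|^2]. *)
Lemma holomorphic_constant_zero (K : 'rV[R]_N -> 'rV[R]_N -> 'rV[R]_N -> 'rV[R]_N -> R)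
    (c : R) :
  (forall v, v != 0 -> 0 < ip G v v) ->
  (forall u v w : 'rV[R]_n, K (u *m D) (v *m D) xi (w *m D) = 0) ->
  (forall a b, ip G a b = 0 -> ip G a (b *m J) = 0 ->
     K a (a *m J) b (b *m J) = - (2 * c) * (ip G a a * ip G b b)) ->
  c = 0.
Proof.
move=> posG K0 Kc.
have [w xiw] := J_normal_tangent.
have [u [v [uD0 uJ]]] := holomorphic_direction.
have uxiJ : ip G (u *m D) (xi *m J) = 0.
  have := isoJ (u *m D) (xi *m J); rewrite -[xi *m J *m J]mulmxA JJ mulmxN mulmx1 ipNr.
  by rewrite uJ xiD oppr0.
have := Kc (u *m D) xi (xiD u) uxiJ.
rewrite uJ xiw K0 xi1 mulr1 => h.
have := posG _ uD0; move: h; move: (ip G _ _) => q h q0.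
apply/eqP; have : c * q = 0 by lra.
by move/eqP; rewrite mulf_eq0 [q == 0]gt_eqF// orbF.
Qed.

End MaximalCR.

(** * Linear differential equations on the unit interval *)

Lemma mx_MVT (R : realType) m n (Z dZ : R -> 'M[R]_(m, n)) (C : R) :
  (forall t : R, 0 <= t <= 1 -> is_derive t 1 Z (dZ t)) ->
  (forall t : R, 0 <= t <= 1 -> `|dZ t| <= C) ->
  forall t : R, 0 <= t <= 1 -> `|Z t - Z 0| <= C.
Proof.
move=> isZ bd t /andP[t0 t1].
have C0 : 0 <= C by apply: le_trans (bd 0 _); rewrite ?lexx ?ler01.
apply: mx_norm_le => // i j; rewrite !mxE.
have isZij (s : R) : 0 <= s <= 1 -> is_derive s 1 (fun s => Z s i j) (dZ s i j).
  by move=> s01; apply: is_derive_entry; exact: isZ.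
have sub (s : R) : s \in `[0, t] -> 0 <= s <= 1.
  by rewrite in_itv/= => /andP[s0 st]; rewrite s0 (le_trans st).
have [s||s] := @MVT_segment R (fun s => Z s i j) (fun s => dZ s i j) 0 t t0.
- rewrite in_itv/= => /andP[s0 st]; apply: isZij.
  by rewrite !ltW// (lt_le_trans st).
- apply: derivable_within_continuous => s /sub s01.
  by have [] := isZij s s01.
move=> /sub s01 ->; rewrite subr0 normrM (ger0_norm t0).
apply: le_trans (_ : `|dZ s i j| * 1 <= _); first by rewrite ler_wpM2l.
by rewrite mulr1 (le_trans (entry_le_norm _ _ _))// bd.
Qed.

Lemma is_derive_continuous (R : realType) m n (Z : R -> 'M[R]_(m, n)) dZ (t : R) :
  is_derive t 1 Z dZ -> {for t, continuous Z}.
Proof.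
by move=> [/derivable1_diffP dt _]; exact: differentiable_continuous.
Qed.

(** A Gronwall inequality: at a maximum of [|Z|] the mean value theorem gives
    [M <= M / 2 + e]. *)
Lemma linear_growth_bound (R : realType) m n (Z dZ : R -> 'M[R]_(m, n)) (e : R) :
  (forall t : R, 0 <= t <= 1 -> is_derive t 1 Z (dZ t)) -> Z 0 = 0 ->
  (forall t : R, 0 <= t <= 1 -> `|dZ t| <= 2^-1 * `|Z t| + e) ->
  forall t : R, 0 <= t <= 1 -> `|Z t| <= 2 * e.
Proof.
move=> isZ Z0 bd t t01.
have [||c c01 cmax] := @EVT_max R (fun t => `|Z t|) 0 1.
- exact: ler01.
- apply: continuous_in_subspaceT => s; rewrite inE/= in_itv/= => s01.
  have cZ := is_derive_continuous (isZ s s01).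
  exact: (continuous_comp cZ (@norm_continuous _ _ _)).
have c01' : 0 <= c <= 1 by move: c01; rewrite in_itv.
have tmax (s : R) : 0 <= s <= 1 -> `|Z s| <= `|Z c| by move=> s01; apply: cmax; rewrite in_itv.
have := @mx_MVT R m n Z dZ (2^-1 * `|Z c| + e) isZ _ c c01'.
rewrite Z0 subr0 => h.
have {}h : `|Z c| <= 2^-1 * `|Z c| + e.
  by apply: h => s s01; apply: le_trans (bd s s01) _; have := tmax s s01; lra.
have := tmax t t01; lra.
Qed.

Section Primitive.
Context {R : realType}.

(** Composing with [clamp] extends a function given on the unit interval to a
    continuous function on the line, keeping the derivatives at the end points
    two-sided. *)
Let clamp (t : R) : R := Num.max 0 (Num.min 1 t).

Let clamp01 t : 0 <= clamp t <= 1.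
Proof. by rewrite /clamp le_max lexx/= ge_max ler01 ge_min lexx. Qed.

Let clamp_id t : 0 <= t <= 1 -> clamp t = t.
Proof. by move=> /andP[t0 t1]; rewrite /clamp (min_idPr t1) (max_idPr t0). Qed.

Let clamp_continuous : continuous clamp.
Proof.
move=> t.
have c0 (a : R) : {for t, continuous (cst a : R -> R^o)} by exact: cst_continuous.
have ci : {for t, continuous (id : R -> R^o)} by exact: cvg_id.
exact: continuous_max (c0 0) (continuous_min (c0 1) ci).
Qed.

Lemma continuous_clamp (T : topologicalType) (f : R -> T) :
  (forall t : R, 0 <= t <= 1 -> {for t, continuous f}) -> continuous (f \o clamp).
Proof.
by move=> cf t; apply: continuous_comp; [exact: clamp_continuous|exact/cf/clamp01].
Qed.

(** The integral starts at [-1] because the fundamental theorem of calculus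
    requires points to the right of the lower bound, and [0] is to be one. *)
Lemma primitive01 (f : R -> R) :
  (forall t : R, 0 <= t <= 1 -> {for t, continuous f}) ->
  exists2 F : R -> R, F 0 = 0 & forall t : R, 0 <= t <= 1 -> is_derive t 1 F (f t).
Proof.
move=> /continuous_clamp cf.
pose F0 (x : R) := (\int[lebesgue_measure]_(t in `[(-1)%R, x]) (f \o clamp) t)%R.
exists (fun x => F0 x - F0 0); first by rewrite subrr.
move=> t t01.
have intf : lebesgue_measure.-integrable `[(-1)%R, 2%R] (EFin \o (f \o clamp)).
  apply: continuous_compact_integrable; first exact: segment_compact.
  exact: continuous_subspaceT.
have [t0 t1] := andP t01.
have t2 : t < 2 by rewrite (le_lt_trans t1)// ltrDl.
have tN1 : -1 < t by rewrite (lt_le_trans _ t0)// oppr_lt0.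
have [dF eF] := @continuous_FTC1_closed R (f \o clamp) (-1) t 2 t2 intf tN1 (cf t).
rewrite -[f t]subr0; apply: is_deriveB.
by apply: DeriveDef => //; rewrite -derive1E eF /= clamp_id.
Qed.

Lemma mx_primitive01 m n (f : R -> 'M[R]_(m, n)) :
  (forall t : R, 0 <= t <= 1 -> {for t, continuous f}) ->
  exists2 F : R -> 'M[R]_(m, n), F 0 = 0 &
    forall t : R, 0 <= t <= 1 -> is_derive t 1 F (f t).
Proof.
move=> cf; have ex i j : exists F : R -> R, F 0 = 0 /\
    forall t : R, 0 <= t <= 1 -> is_derive t 1 F (f t i j).
  have [|F F0 dF] := @primitive01 (fun t => f t i j); last by exists F.
  move=> t t01; have := continuous_comp (cf t t01) (@coord_continuous R m n i j (f t)).
  exact.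
pose F i j := sval (cid (ex i j)).
exists (fun t => \matrix_(i, j) F i j t).
  by apply/matrixP => i j; rewrite !mxE /F; case: cid => ? [].
move=> t t01; apply: is_derive_mx => i j; under eq_fun do rewrite mxE.
by rewrite /F; case: cid => ? [] /= _; exact.
Qed.

(** The sequences [a k - e k] and [a k + e k], for the tails [e k] of the geometric
    series, are monotone and enclose each other; the limit is the supremum of the
    lower one. *)
Lemma geometric_limit (a : nat -> R) (C : R) :
  (forall k, `|a k.+1 - a k| <= C / 2 ^+ k) ->
  exists l, forall k, `|a k - l| <= 2 * C / 2 ^+ k.
Proof.
move=> h.
pose e k : R := 2 * C / 2 ^+ k.
have step k : `|a k.+1 - a k| <= e k - e k.+1.
  apply: le_trans (h k) _; rewrite /e exprS le_eqVlt; apply/orP; left; apply/eqP.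
  by field; rewrite ?expf_neq0// pnatr_eq0.
have C0 : 0 <= C by have := h 0%N; rewrite expr0 divr1; apply: le_trans.
have e0 k : 0 <= e k by rewrite /e !mulr_ge0// invr_ge0 exprn_ge0.
have mono k j : a k - e k <= a (k + j)%N - e (k + j)%N /\ a (k + j)%N + e (k + j)%N <= a k + e k.
  elim: j => [|j [IH1 IH2]]; first by rewrite addn0.
  by have := step (k + j)%N; rewrite addnS ler_norml => /andP[]; lra.
have cross k j : a k - e k <= a j + e j.
  have [kj|/ltnW jk] := leqP k j.
    by have [+ _] := mono k (j - k)%N; rewrite subnKC//; have := e0 j; lra.
  by have [_] := mono j (k - j)%N; rewrite subnKC//; have := e0 k; lra.
pose S := range (fun k => a k - e k).
have S0 : S !=set0 by exists (a 0%N - e 0%N); exists 0%N.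
exists (sup S) => k; rewrite -/(e k) ler_norml; apply/andP; split.
  have : sup S <= a k + e k by apply: ge_sup => // _ [j _ <-].
  lra.
have : a k - e k <= sup S.
  apply: ub_le_sup; last by exists k.
  by exists (a 0%N + e 0%N) => _ [j _ <-].
lra.
Qed.

Lemma mx_geometric_limit m n (A : nat -> 'M[R]_(m, n)) (C : R) :
  (forall k, `|A k.+1 - A k| <= C / 2 ^+ k) ->
  exists L, forall k, `|A k - L| <= 2 * C / 2 ^+ k.
Proof.
move=> h; have ex i j : exists l, forall k, `|A k i j - l| <= 2 * C / 2 ^+ k.
  apply: geometric_limit => k; apply: le_trans (h k).
  by have := entry_le_norm (A k.+1 - A k) i j; rewrite !mxE.
have C0 : 0 <= C by have := h 0%N; rewrite expr0 divr1; apply: le_trans.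
exists (\matrix_(i, j) sval (cid (ex i j))) => k; apply: mx_norm_le.
  by rewrite !mulr_ge0// invr_ge0 exprn_ge0.
by move=> i j; rewrite !mxE; case: cid.
Qed.

Lemma geometric_small (C e : R) : 0 < e -> exists k : nat, C / 2 ^+ k <= e.
Proof.
move=> e0; exists (Num.bound (C / e)).
rewrite ler_pdivrMr ?exprn_gt0// mulrC -ler_pdivrMr//.
have [C0|C0] := leP (C / e) 0; first by rewrite (le_trans C0)// exprn_ge0.
apply: ltW; apply: lt_le_trans (archi_boundP (ltW C0)) _.
by rewrite -natrX ler_nat ltnW// ltn_expl.
Qed.

Lemma uniform_limit_continuous (T : topologicalType) m n
    (Y : nat -> T -> 'M[R]_(m, n)) (L : T -> 'M[R]_(m, n)) (C : R) :
  (forall k, continuous (Y k)) -> (forall k t, `|Y k t - L t| <= C / 2 ^+ k) ->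
  continuous L.
Proof.
move=> cY h t; apply/cvgrPdist_le => e e0.
have e3 : 0 < e / 3 by lra.
have [k hk] := geometric_small C e3.
have /cvgrPdist_le/(_ (e / 3)) hY := cY k t.
have := hY e3; apply: filterS => s hs.
have -> : L t - L s = (Y k t - Y k s) - (Y k t - L t) + (Y k s - L s).
  by rewrite opprB [_ + (L t - _)]addrC !addrA !subrK.
have := h k t; have := h k s => h1 h2.
apply: le_trans (ler_normD _ _) _.
have := ler_normB (Y k t - Y k s) (Y k t - L t); lra.
Qed.

(** Picard iteration.  As [n |B|] is at most one half, where the factor [n] comes from
    the norm of a matrix product, each step halves the distance between successive
    iterates on the whole unit interval. *)
Theorem linear_ode_exists n (B : R -> 'M[R]_n) (x0 : 'rV[R]_n) :
  (forall t : R, 0 <= t <= 1 -> {for t, continuous B}) ->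
  (forall t : R, 0 <= t <= 1 -> n%:R * `|B t| <= 2^-1) ->
  exists X : R -> 'rV[R]_n, X 0 = x0 /\
    forall t : R, 0 <= t <= 1 -> is_derive t 1 X (X t *m B t).
Proof.
move=> cB smallB.
pose cont (X : R -> 'rV[R]_n) := forall t : R, 0 <= t <= 1 -> {for t, continuous X}.
pose step (X X' : R -> 'rV[R]_n) := X' 0 = x0 /\
  forall t : R, 0 <= t <= 1 -> is_derive t 1 X' (X t *m B t).
have step_cont X X' : step X X' -> cont X'.
  by move=> [_ dX'] t t01; exact: is_derive_continuous (dX' t t01).
have small (x : 'rV[R]_n) (t : R) : 0 <= t <= 1 -> `|x *m B t| <= 2^-1 * `|x|.
  move=> t01; apply: le_trans (mulmx_norm_le _ _) _.
  by rewrite mulrCA [leRHS]mulrC ler_wpM2l// smallB.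
have ex X : exists X', cont X -> step X X'.
  have [cX|ncX] := pselect (cont X); last by exists X.
  have [|F F0 dF] := @mx_primitive01 _ _ (fun t => X t *m B t).
    by move=> t t01; apply: continuous_mulmx; [exact: cX|exact: cB].
  exists (fun t => x0 + F t) => _; split; first by rewrite F0 addr0.
  move=> t t01; rewrite -[_ *m _]add0r; apply: is_deriveD.
  exact: dF.
pose T X := sval (cid (ex X)).
have TP X : cont X -> step X (T X) by rewrite /T; case: cid.
have [X [X00 X0 cX dX]] : exists X : nat -> R -> 'rV[R]_n,
    [/\ forall t, X 0%N t = x0, forall k, X k 0 = x0, forall k, cont (X k) &
     forall k (t : R), 0 <= t <= 1 -> is_derive t 1 (X k.+1) (X k t *m B t)].
  have cX k : cont (iter k T (cst x0)).
    elim: k => [|k IH]; first by move=> t _; exact: cst_continuous.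
    exact/step_cont/TP.
  exists (fun k => iter k T (cst x0)); split=> //.
    by case=> [//|k]; have [] := TP _ (cX k).
  by move=> k; have [] := TP _ (cX k).
have est k : forall t : R, 0 <= t <= 1 -> `|X k.+1 t - X k t| <= `|x0| / 2 ^+ k.
  elim: k => [|k IH] t t01.
    rewrite expr0 divr1 X00 -(X0 1%N).
    apply: mx_MVT (dX 0%N) _ t t01 => s s01; rewrite X0.
    by apply: le_trans (small _ s s01) _; rewrite X00; have := normr_ge0 x0; lra.
  have := @mx_MVT _ _ _ (fun t => X k.+2 t - X k.+1 t) (fun t => (X k.+1 t - X k t) *m B t)
     (`|x0| / 2 ^+ k.+1).
  rewrite !X0 subrr => /(_ _ _ t t01); rewrite subr0; apply => s s01.
    by rewrite mulmxBl; apply: is_deriveB; exact: dX.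
  apply: le_trans (small _ s s01) _.
  by rewrite exprS invfM mulrCA ler_wpM2l// IH.
have exL t := mx_geometric_limit (fun k => est k _ (clamp01 t)).
(* the limit of the iterates, precomposed with the clamp to be continuous on
   the line *)
pose Y t := sval (cid (exL t)).
have XY k t : `|X k (clamp t) - Y t| <= 2 * `|x0| / 2 ^+ k by rewrite /Y; case: cid.
have cY : continuous Y.
  apply: (@uniform_limit_continuous _ _ _ (fun k => X k \o clamp)) XY => k.
  exact: (continuous_clamp (cX k)).
have [Z0 dZ] := TP Y (fun t _ => cY t).
exists (T Y); split=> // t t01.
(* one more Picard step applied to the limit gives back the limit *)
suff -> : T Y t = Y t by exact: dZ.
apply/eqP; rewrite -subr_eq0 -normr_le0; apply/ler_addgt0Pl => e e0; rewrite addr0.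
have [k hk] := geometric_small (4 * `|x0|) e0.
apply: le_trans hk.
have h1 := XY k.+1 t; rewrite clamp_id// in h1.
have h2 : `|T Y t - X k.+1 t| <= `|x0| / 2 ^+ k.
  have := @mx_MVT _ _ _ (fun t => T Y t - X k.+1 t) (fun t => (Y t - X k t) *m B t)
     (`|x0| / 2 ^+ k).
  rewrite !X0 Z0 subrr => /(_ _ _ t t01); rewrite subr0; apply => s s01.
    by rewrite mulmxBl; apply: is_deriveB; [exact: dZ|exact: dX].
  apply: le_trans (small _ s s01) _.
  rewrite distrC; have := XY k s; rewrite clamp_id//; lra.
have -> : T Y t - Y t = (T Y t - X k.+1 t) + (X k.+1 t - Y t) by rewrite addrA subrK.
apply: le_trans (ler_normD _ _) _.
have z0 : 0 <= `|x0| / 2 ^+ k by rewrite mulr_ge0// invr_ge0 exprn_ge0.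
have e1 : 4 * `|x0| / 2 ^+ k = 4 * (`|x0| / 2 ^+ k) by rewrite mulrA.
have e2 : 2 * `|x0| / 2 ^+ k.+1 = `|x0| / 2 ^+ k.
  by rewrite exprS; field; rewrite expf_neq0// pnatr_eq0.
rewrite e2 in h1; rewrite e1; lra.
Qed.

End Primitive.

(** * Uniform second-order bounds *)

Lemma ball_segment (R : realType) n (y0 y z : 'rV[R]_n) (r t : R) :
  `|y - y0| < r -> `|z - y0| < r -> 0 <= t <= 1 ->
  `|y + t *: (z - y) - y0| < r.
Proof.
move=> h1 h2 /andP[t0 t1].
have -> : y + t *: (z - y) - y0 = (1 - t) *: (y - y0) + t *: (z - y0).
  have -> : z - y = (z - y0) - (y - y0) by rewrite opprB addrA subrK.
  by rewrite scalerBl scale1r (scalerBr t) addrAC -[RHS]addrA [- _ + _]addrC.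
apply: le_lt_trans (ler_normD _ _) _; rewrite !normrZ (ger0_norm t0).
have t1' : 0 <= 1 - t by lra.
rewrite (ger0_norm t1').
move: h1 h2; move: (`|y - y0|) (`|z - y0|) => p q h1 h2.
have [->|tn0] := eqVneq t 0; first by rewrite subr0 mul1r mul0r addr0.
have tp : 0 < t by rewrite lt_neqAle eq_sym tn0.
nra.
Qed.

Lemma sum_scale_bound (R : realType) d m n (v : 'rV[R]_d)
    (M : 'I_d -> 'M[R]_(m, n)) (C : R) :
  (forall j, `|M j| <= C) -> `|\sum_j v 0 j *: M j| <= d%:R * (`|v| * C).
Proof.
move=> hM; apply: le_trans (ler_norm_sum _ _ _) _.
apply: le_trans (_ : \sum_(j < d) `|v| * C <= _).
  by apply: ler_sum => j _; rewrite normrZ ler_pM// entry_le_norm.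
by rewrite sumr_const card_ord mulr_natl.
Qed.

Section LocalBounds.
Context {R : realType} {d : nat} (V : set 'rV[R]_d) (oV : open V).

Lemma derive_sum_basis m n (H : 'rV[R]_d -> 'M[R]_(m, n)) (y v : 'rV[R]_d) :
  smooth_on V H -> V y -> 'D_v H y = \sum_j v 0 j *: 'D_(delta_mx 0 j) H y.
Proof.
move=> sH Vy; have dH := smooth_differentiable sH Vy.
rewrite deriveE// [v in LHS]row_sum_delta linear_sum; apply: eq_bigr => j _.
by rewrite linearZ -deriveE.
Qed.

Lemma near_norm_bound m n (H : 'rV[R]_d -> 'M[R]_(m, n)) (y0 : 'rV[R]_d) :
  smooth_on V H -> V y0 -> \forall y \near y0, `|H y| <= `|H y0| + 1.
Proof.
move=> sH Vy0; have cH := differentiable_continuous (smooth_differentiable sH Vy0).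
have /cvgrPdist_le/(_ 1 ltr01) := cH; apply: filterS => y hy.
have -> : H y = H y0 - (H y0 - H y) by rewrite opprB addrC subrK.
by apply: le_trans (ler_normB _ _) _; rewrite lerD2l.
Qed.

(** A continuous function is bounded near a point; this is applied to the
    functions [H i] and their first and second partial derivatives. *)
Lemma C2_bounds m n p (H : 'I_p -> 'rV[R]_d -> 'M[R]_(m, n)) (y0 : 'rV[R]_d) :
  (forall i, smooth_on V (H i)) -> V y0 ->
  exists r C : R, [/\ 0 < r, 0 <= C & forall y, `|y - y0| < r ->
    [/\ V y, forall i, `|H i y| <= C, forall i v, `|'D_v (H i) y| <= C * `|v| &
        forall i v, `|'D_v ('D_v (H i)) y| <= C * (`|v| * `|v|)]].
Proof.
move=> sH Vy0; pose e j : 'rV[R]_d := delta_mx 0 j.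
have sD i v : smooth_on V ('D_v (H i)) by exact: smooth_derive.
have sDD i v w : smooth_on V ('D_w ('D_v (H i))) by exact: smooth_derive.
(* sums over all indices serve as common upper bounds *)
pose C0 := \sum_i (`|H i y0| + 1).
pose C1 := \sum_i \sum_j (`|'D_(e j) (H i) y0| + 1).
pose C2 := \sum_i \sum_j \sum_k (`|'D_(e j) ('D_(e k) (H i)) y0| + 1).
have pos (x : R) : 0 <= x -> 0 <= x + 1 by move=> x0; rewrite addr_ge0.
have le_sum (I : finType) (f : I -> R) i : (forall i, 0 <= f i) -> f i <= \sum_i f i.
  by move=> f0; rewrite (bigD1 i)//= lerDl sumr_ge0.
have all_near (I : finType) (f : I -> set 'rV[R]_d) :
    (forall i, \forall y \near y0, f i y) -> \forall y \near y0, forall i, f i y.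
  by move=> h; exact: (@filter_forall _ I f (nbhs y0) (nbhs_filter y0) h).
have near0 : \forall y \near y0, V y /\ [/\ forall i, `|H i y| <= C0,
    forall i j, `|'D_(e j) (H i) y| <= C1 &
    forall i j k, `|'D_(e j) ('D_(e k) (H i)) y| <= C2].
  have n0 : \forall y \near y0, forall i, `|H i y| <= C0.
    apply: (all_near _ (fun i y => `|H i y| <= C0)) => i.
    apply: filterS (near_norm_bound (sH i) Vy0) => y hy.
    by apply: le_trans hy (le_sum _ (fun i => `|H i y0| + 1) i _) => i'; exact: pos.
  have n1 : \forall y \near y0, forall i j, `|'D_(e j) (H i) y| <= C1.
    apply: (all_near _ (fun i y => forall j, `|'D_(e j) (H i) y| <= C1)) => i.
    apply: (all_near _ (fun j y => `|'D_(e j) (H i) y| <= C1)) => j.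
    apply: filterS (near_norm_bound (sD i (e j)) Vy0) => y hy.
    apply: le_trans hy _.
    apply: le_trans (le_sum _ (fun j => `|'D_(e j) (H i) y0| + 1) j _) _.
      by move=> j'; exact: pos.
    apply: (le_sum _ (fun i => \sum_j (`|'D_(e j) (H i) y0| + 1))) => i'.
    by apply: sumr_ge0 => j' _; exact: pos.
  have n2 : \forall y \near y0, forall i j k, `|'D_(e j) ('D_(e k) (H i)) y| <= C2.
    apply: (all_near _ (fun i y => forall j k, `|'D_(e j) ('D_(e k) (H i)) y| <= C2)) => i.
    apply: (all_near _ (fun j y => forall k, `|'D_(e j) ('D_(e k) (H i)) y| <= C2)) => j.
    apply: (all_near _ (fun k y => `|'D_(e j) ('D_(e k) (H i)) y| <= C2)) => k.
    apply: filterS (near_norm_bound (sDD i (e k) (e j)) Vy0) => y hy.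
    apply: le_trans hy _.
    apply: le_trans (le_sum _ (fun k => `|'D_(e j) ('D_(e k) (H i)) y0| + 1) k _) _.
      by move=> k'; exact: pos.
    apply: le_trans (le_sum _ (fun j => \sum_k (`|'D_(e j) ('D_(e k) (H i)) y0| + 1)) j _) _.
      by move=> j'; apply: sumr_ge0 => k' _; exact: pos.
    apply: (le_sum _ (fun i => \sum_j \sum_k (`|'D_(e j) ('D_(e k) (H i)) y0| + 1))) => i'.
    by apply: sumr_ge0 => j' _; apply: sumr_ge0 => k' _; exact: pos.
  have nV : \forall y \near y0, V y by exact: open_nbhs_nbhs.
  apply: filterS (filterI nV (filterI n0 (filterI n1 n2))) => y [? [? [? ?]]].
  by split.
have /nbhs_ballP[r /= r0 hr] := near0.
have C00 : 0 <= C0 by apply: sumr_ge0 => i _; exact: pos.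
have C10 : 0 <= C1 by apply: sumr_ge0 => i _; apply: sumr_ge0 => j _; exact: pos.
have C20 : 0 <= C2.
  by apply: sumr_ge0 => i _; apply: sumr_ge0 => j _; apply: sumr_ge0 => k _; exact: pos.
have d0 : 0 <= d%:R :> R by [].
exists r, (C0 + d%:R * C1 + d%:R * (d%:R * C2)); split=> //.
  by rewrite !addr_ge0// !mulr_ge0.
move=> y yr; have [|Vy [b0 b1 b2]] := hr y.
  by rewrite -ball_normE /= distrC.
have dC1 : 0 <= d%:R * C1 by exact: mulr_ge0.
have dC2 : 0 <= d%:R * (d%:R * C2) by rewrite !mulr_ge0.
split=> // [i|i v|i v].
- by apply: le_trans (b0 i) _; rewrite -addrA lerDl addr_ge0.
- rewrite (derive_sum_basis _ (sH i) Vy); apply: le_trans (sum_scale_bound _ (b1 i)) _.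
  rewrite mulrCA mulrC ler_wpM2r//.
  by rewrite addrAC lerDr addr_ge0.
- rewrite (derive_sum_basis _ (sD i v) Vy).
  have hk k : `|'D_(e k) ('D_v (H i)) y| <= d%:R * (`|v| * C2).
    rewrite (derive_swap oV _ _ (sH i) Vy) (derive_sum_basis _ (sD i (e k)) Vy).
    by apply: sum_scale_bound => j; exact: b2.
  apply: le_trans (sum_scale_bound _ hk) _.
  have -> : d%:R * (`|v| * (d%:R * (`|v| * C2))) = d%:R * (d%:R * C2) * (`|v| * `|v|).
    by move: (`|v|) => x; ring.
  by rewrite ler_wpM2r ?mulr_ge0// lerDr addr_ge0.
Qed.

Lemma lipschitz_on_segment m n (H : 'rV[R]_d -> 'M[R]_(m, n)) (y v : 'rV[R]_d) (C : R) :
  smooth_on V H ->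
  (forall t : R, 0 <= t <= 1 -> V (y + t *: v) /\ `|'D_v H (y + t *: v)| <= C) ->
  `|H (y + v) - H y| <= C.
Proof.
move=> sH hC.
have := @mx_MVT R m n (fun t => H (y + t *: v)) (fun t => 'D_v H (y + t *: v)) C.
move=> /(_ _ _ 1); rewrite scale1r scale0r addr0; apply.
- move=> t t01; apply: is_derive_line; have [Vt _] := hC t t01.
  exact: smooth_differentiable Vt.
- by move=> t t01; have [] := hC t t01.
- by rewrite ler01 lexx.
Qed.

Lemma taylor_on_segment m n (H : 'rV[R]_d -> 'M[R]_(m, n)) (y v : 'rV[R]_d) (C : R) :
  smooth_on V H ->
  (forall t : R, 0 <= t <= 1 -> V (y + t *: v) /\ `|'D_v ('D_v H) (y + t *: v)| <= C) ->
  `|H (y + v) - H y - 'D_v H y| <= C.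
Proof.
move=> sH hC.
have C0 : 0 <= C by have [_] := hC 0 ltac:(by rewrite lexx ler01); exact: le_trans.
have sD : smooth_on V ('D_v H) by exact: smooth_derive.
have := @mx_MVT R m n (fun t => H (y + t *: v) - t *: 'D_v H y)
  (fun t => 'D_v H (y + t *: v) - 'D_v H y) C.
move=> /(_ _ _ 1); rewrite !scale1r !scale0r addr0 subr0.
rewrite [X in _ -> _ -> _ -> `|X| <= _]addrAC; apply.
- move=> t t01; apply: is_deriveB.
    apply: is_derive_line; have [Vt _] := hC t t01.
    exact: smooth_differentiable Vt.
  have := is_derive_scalemx (@is_derive_id R R t 1) (is_derive_cst ('D_v H y) t 1).
  by rewrite scaler0 addr0 scale1r.
- move=> t /andP[t0 t1].
  have h : `|'D_v H (y + t *: v) - 'D_v H y| <= t * C.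
    apply: (lipschitz_on_segment sD) => s /andP[s0 s1].
    have st01 : 0 <= s * t <= 1 by rewrite mulr_ge0//= mulr_ile1.
    rewrite scalerA; have [Vst bst] := hC (s * t) st01; split=> //.
    have -> : 'D_(t *: v) ('D_v H) (y + (s * t) *: v) = t *: 'D_v ('D_v H) (y + (s * t) *: v).
      have dH := smooth_differentiable sD Vst.
      by rewrite deriveE// linearZ -deriveE.
    by rewrite normrZ (ger0_norm t0) ler_wpM2l.
  by apply: le_trans h _; rewrite ler_piMl.
- by rewrite ler01 lexx.
Qed.

End LocalBounds.

(** * Flat linear systems *)

(** In [flat_system_solvable], the derivative of
    [Xv - X - t *: (X *m tv)], where [X' = X *m ta] and [Xv' = Xv *m P], is a
    multiple of this quantity itself up to second-order errors [E1] and [E2]: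
    flatness, the first hypothesis, removes all the terms of first order. *)
Lemma transport_defect_algebra (R : realType) K (t : R) (X Xv : 'rV[R]_K)
    (ta tv P Dav Dva E1 E2 : 'M[R]_K) :
  Dva - Dav = ta *m tv - tv *m ta -> P = ta + t *: Dva + E1 + (tv + E2) ->
  Xv *m P - X *m ta - (X *m tv + t *: (X *m ta *m tv + X *m Dav)) =
  (Xv - X - t *: (X *m tv)) *m P + X *m (E1 + E2 + t *: (tv *m (P - ta))).
Proof.
move=> /(canRL (subrK _)) -> ->.
rewrite !(mulmxDl, mulmxDr, mulNmx, mulmxN, =^~ scalemxAl, =^~ scalemxAr, mulmxA, scalerDr, scalerN).
mx_ring.
Qed.

Section FlatSystem.
Context {R : realType} {d K : nat} (V : set 'rV[R]_d) (oV : open V).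
Implicit Types (u v w y : 'rV[R]_d).
Variables (H : 'I_d -> 'rV[R]_d -> 'M[R]_K) (y0 : 'rV[R]_d).
Hypothesis sH : forall i, smooth_on V (H i).
Hypothesis Vy0 : V y0.

(** The value on [w] of the matrix-valued 1-form with components [H i]. *)
Definition form_at (w y : 'rV[R]_d) : 'M[R]_K := \sum_i w 0 i *: H i y.

Hypothesis flat : forall u v y : 'rV[R]_d, V y ->
  'D_u (form_at v) y - 'D_v (form_at u) y = form_at v y *m form_at u y - form_at u y *m form_at v y.

Lemma form_atD u v y : form_at (u + v) y = form_at u y + form_at v y.
Proof. by rewrite -big_split/=; apply: eq_bigr => i _; rewrite mxE scalerDl. Qed.

Lemma smooth_form_at w : smooth_on V (form_at w).
Proof. by apply: smooth_sum => // i; apply: smooth_scale => // k; exact: Ck_cst. Qed.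

Lemma derive_form_at u w y : V y -> 'D_u (form_at w) y = \sum_i w 0 i *: 'D_u (H i) y.
Proof.
move=> Vy; have h i : is_derive y u (fun z => w 0 i *: H i z) (w 0 i *: 'D_u (H i) y).
  by apply: is_deriveZ; exact: smooth_is_derive.
by have [_] := is_derive_bigsum (index_enum 'I_d) h.
Qed.

Lemma form_at_bounds : exists r L : R, [/\ 0 < r /\ 0 <= L,
  forall y, `|y - y0| < r -> V y,
  forall w y, `|y - y0| < r -> `|form_at w y| <= L * `|w|,
  forall w y v, `|y - y0| < r -> `|y + v - y0| < r ->
    `|form_at w (y + v) - form_at w y| <= L * `|w| * `|v| &
  forall w y v, `|y - y0| < r -> `|y + v - y0| < r ->
    `|form_at w (y + v) - form_at w y - 'D_v (form_at w) y| <= L * `|w| * (`|v| * `|v|)].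
Proof.
have [r [C [r0 C0 hC]]] := C2_bounds oV sH Vy0.
have seg y v : `|y - y0| < r -> `|y + v - y0| < r -> forall t : R, 0 <= t <= 1 ->
    `|y + t *: v - y0| < r.
  move=> h1 h2 t t01; have := ball_segment h1 h2 t01.
  by rewrite [y + v - y]addrAC subrr add0r.
exists r, (d%:R * C); split=> //.
- by rewrite mulr_ge0.
- by move=> y /hC[].
- move=> w y /hC[_ h _ _]; apply: le_trans (sum_scale_bound _ (fun i => h i)) _.
  by rewrite mulrCA mulrC.
- move=> w y v h1 h2; have hs := seg y v h1 h2.
  have hi i : `|H i (y + v) - H i y| <= C * `|v|.
    apply: (lipschitz_on_segment (sH i)) => t t01.
    by have [Vt _ hD _] := hC _ (hs t t01); split.
  rewrite /form_at -sumrB.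
  under eq_bigr do rewrite -scalerBr.
  apply: le_trans (sum_scale_bound _ hi) _.
  by move: (`|w|) (`|v|) => p q; rewrite le_eqVlt; apply/orP; left; apply/eqP; ring.
- move=> w y v h1 h2; have hs := seg y v h1 h2.
  have [Vy _ _ _] := hC _ h1.
  have hi i : `|H i (y + v) - H i y - 'D_v (H i) y| <= C * (`|v| * `|v|).
    apply: (taylor_on_segment (V := V)) => // t t01.
    by have [Vt _ _ hD] := hC _ (hs t t01); split.
  rewrite (derive_form_at _ _ Vy) /form_at -!sumrB.
  under eq_bigr do rewrite -!scalerBr.
  apply: le_trans (sum_scale_bound _ hi) _.
  by move: (`|w|) (`|v|) => p q; rewrite le_eqVlt; apply/orP; left; apply/eqP; ring.
Qed.

(** The value [om y] is obtained by transporting [e] along the segment from [y0]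
    to [y].  To differentiate [om] at [y], compare the transports [X a] and
    [X (a + v)] towards [y = y0 + a] and [y + v]: their difference is
    [t *: (X a t *m form_at v)] up to an error [Z t] that satisfies, by
    [transport_defect_algebra], a linear differential inequality with right-hand
    side of order [|v|^2], so that [linear_growth_bound] applies. *)
Theorem flat_system_solvable : exists2 r : R, 0 < r &
  (forall y, `|y - y0| < r -> V y) /\
  forall e : 'rV[R]_K, exists2 om : 'rV[R]_d -> 'rV[R]_K, om y0 = e &
    forall y, `|y - y0| < r ->
      differentiable om y /\ forall u, 'D_u om y = om y *m form_at u y.
Proof.
have [r0 [L [[r00 L0] inV b0 b1 b2]]] := form_at_bounds.
have K0 : 0 <= K%:R :> R by [].
(* so small that, on each ray, the form satisfies the smallness hypothesis of
   [linear_ode_exists] *)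
pose r := Num.min r0 (Num.min 1 (2^-1 / (K%:R * L + 1))).
have KL0 : 0 < K%:R * L + 1 by rewrite ltr_wpDl// mulr_ge0.
have rp : 0 < r by rewrite /r !lt_min r00 ltr01 divr_gt0// invr_gt0.
have rr0 : r <= r0 by rewrite /r ge_min lexx.
have r1 : r <= 1 by rewrite /r !ge_min lexx orbT.
have rKL : K%:R * (L * r) <= 2^-1.
  have : r <= 2^-1 / (K%:R * L + 1) by rewrite /r !ge_min lexx !orbT.
  rewrite ler_pdivlMr// => h.
  by rewrite mulrA mulrC; apply: le_trans h; rewrite ler_wpM2l ?lerDl// ltW.
have sf := smooth_form_at.
have lt_r0 y : `|y - y0| < r -> `|y - y0| < r0 by move=> h; exact: lt_le_trans h rr0.
have ray a t : `|a| < r -> 0 <= t <= 1 -> `|y0 + t *: a - y0| < r.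
  move=> ar /andP[t0 t1]; rewrite [y0 + _]addrC addrK normrZ (ger0_norm t0).
  by apply: le_lt_trans ar; rewrite ler_piMl.
have small a t : `|a| < r -> 0 <= t <= 1 -> K%:R * `|form_at a (y0 + t *: a)| <= 2^-1.
  move=> ar t01; apply: le_trans rKL; rewrite ler_wpM2l//.
  apply: le_trans (b0 a _ (lt_r0 _ (ray a t ar t01))) _.
  by rewrite ler_wpM2l// ltW.
exists r => //; split=> [y /lt_r0 /inV//|e].
have ex a : exists X : R -> 'rV[R]_K, `|a| < r -> X 0 = e /\
    forall t : R, 0 <= t <= 1 -> is_derive t 1 X (X t *m form_at a (y0 + t *: a)).
  have [ar|_] := boolP (`|a| < r); last by exists (cst 0).
  have [|X [X0 dX]] := @linear_ode_exists R K (fun t => form_at a (y0 + t *: a)) e _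
      (fun t => small a t ar); last by exists X.
  move=> t t01; have Vt := inV _ (lt_r0 _ (ray a t ar t01)).
  apply: is_derive_continuous.
  exact: (is_derive_line (smooth_differentiable (sf a) Vt)).
pose X a := sval (cid (ex a)).
have XP a : `|a| < r -> X a 0 = e /\
    forall t : R, 0 <= t <= 1 -> is_derive t 1 (X a) (X a t *m form_at a (y0 + t *: a)).
  by rewrite /X; case: cid.
have Xbound a t : `|a| < r -> 0 <= t <= 1 -> `|X a t| <= 2 * `|e|.
  move=> ar t01; have [X0 dX] := XP a ar.
  have h : `|X a t - e| <= 2 * (2^-1 * `|e|).
    apply: (@linear_growth_bound _ _ _ (fun t => X a t - e)
       (fun t => X a t *m form_at a (y0 + t *: a))) t01 => [s s01||s s01].
    - by rewrite -[_ *m _]subr0; apply: is_deriveB; exact: dX.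
    - by rewrite X0 subrr.
    - apply: le_trans (mulmx_norm_le _ _) _; rewrite mulrCA mulrC.
      have h1 : `|X a s| <= `|X a s - e| + `|e| by rewrite -{1}[X a s](subrK e) ler_normD.
      apply: le_trans (_ : 2^-1 * `|X a s| <= _); first by rewrite ler_wpM2r// small.
      by lra.
  have : `|X a t| <= `|X a t - e| + `|e| by rewrite -{1}[X a t](subrK e) ler_normD.
  by lra.
exists (fun y => X (y - y0) 1).
  rewrite subrr; have z0 : `|0 : 'rV[R]_d| < r by rewrite normr0.
  have [X0 dX] := XP 0 z0.
  have f0 y : form_at 0 y = 0 by apply: big1 => i _; rewrite mxE scale0r.
  have h : `|X 0 1 - X 0 0| <= 0.
    apply: (@mx_MVT R _ _ (X 0) (fun=> 0)); last by rewrite ler01 lexx.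
      by move=> t t01; have := dX t t01; rewrite f0 mulmx0.
    by move=> t _; rewrite normr0.
  by apply/eqP; rewrite -subr_eq0 -normr_le0 -X0.
set om := fun y => _.
move=> y yr.
pose C := 2 * (K%:R * ((2 * `|e|) * (2 * L + K%:R * (L * (2 * L))))).
have C0 : 0 <= C by rewrite /C !(mulr_ge0, addr_ge0).
have est v : `|y + v - y0| < r -> `|om (y + v) - om y - om y *m form_at v y| <= C * (`|v| * `|v|).
  move=> yvr; set a := y - y0.
  have av : y + v - y0 = a + v by rewrite addrAC.
  have avr : `|a + v| < r by rewrite -av.
  have [X0 dX] := XP a yr; have [Xv0 dXv] := XP (a + v) avr.
  pose P t := form_at (a + v) (y0 + t *: (a + v)).
  pose ta t := form_at a (y0 + t *: a).
  pose tv t := form_at v (y0 + t *: a).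
  pose Z t := X (a + v) t - X a t - t *: (X a t *m tv t).
  pose dZ t := X (a + v) t *m P t - X a t *m ta t
    - (X a t *m tv t + t *: (X a t *m ta t *m tv t + X a t *m 'D_a (form_at v) (y0 + t *: a))).
  have isZ (t : R) : 0 <= t <= 1 -> is_derive t 1 Z (dZ t).
    move=> t01; have Vt := inV _ (lt_r0 _ (ray a t yr t01)).
    apply: is_deriveB; first by apply: is_deriveB; [exact: dXv|exact: dX].
    have htv := is_derive_line (smooth_differentiable (sf v) Vt).
    have := is_derive_scalemx (@is_derive_id R R t 1) (is_derive_mulmx (dX t t01) htv).
    by rewrite scale1r.
  have Z0 : Z 0 = 0 by rewrite /Z Xv0 X0 subrr scale0r subrr.
  have bZ (t : R) : 0 <= t <= 1 -> `|dZ t| <= 2^-1 * `|Z t| + C / 2 * (`|v| * `|v|).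
    move=> t01; have [t0 t1] := andP t01.
    set p := y0 + t *: a.
    have p' : y0 + t *: (a + v) = p + t *: v by rewrite scalerDr addrA.
    have pr := ray a t yr t01; have pr' := ray (a + v) t avr t01.
    rewrite p' in pr'; have Vp := inV _ (lt_r0 _ pr).
    have {}pr := lt_r0 _ pr; have {}pr' := lt_r0 _ pr'.
    pose E1 := form_at a (p + t *: v) - form_at a p - 'D_(t *: v) (form_at a) p.
    pose E2 := form_at v (p + t *: v) - form_at v p.
    have Dt : 'D_(t *: v) (form_at a) p = t *: 'D_v (form_at a) p.
      by have h := smooth_differentiable (sf a) Vp; rewrite deriveE// linearZ -deriveE.
    have eP : P t = ta t + t *: 'D_v (form_at a) p + E1 + (tv t + E2).
      rewrite /P /ta /tv /E1 /E2 p' form_atD -/p Dt.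
      rewrite [form_at v p + _]addrC subrK; congr (_ + _).
      by rewrite -[X in _ = _ + X]addrA -opprD [RHS]addrC subrK.
    have -> : dZ t = Z t *m P t + X a t *m (E1 + E2 + t *: (tv t *m (P t - ta t))).
      exact: (transport_defect_algebra (X a t) (X (a + v) t) (flat v a Vp) eP).
    have nv0 : 0 <= `|v| by [].
    have na1 : `|a| <= 1 by apply: ltW; exact: lt_le_trans yr r1.
    have ntv : `|t *: v| <= `|v| by rewrite normrZ (ger0_norm t0) ler_piMl.
    have hP : K%:R * `|P t| <= 2^-1 by exact: small.
    have hE1 : `|E1| <= L * (`|v| * `|v|).
      apply: le_trans (b2 a p (t *: v) pr pr') _.
      rewrite -mulrA ler_wpM2l//; apply: le_trans (_ : 1 * (`|v| * `|v|) <= _).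
        by rewrite ler_pM ?mulr_ge0// ler_pM.
      by rewrite mul1r.
    have hE2 : `|E2| <= L * (`|v| * `|v|).
      apply: le_trans (b1 v p (t *: v) pr pr') _.
      by rewrite -mulrA ler_wpM2l// ler_wpM2l.
    have htv : `|tv t| <= L * `|v| by exact: b0.
    have hE3 : `|P t - ta t| <= 2 * L * `|v|.
      have -> : P t - ta t = (form_at a (p + t *: v) - form_at a p) + form_at v (p + t *: v).
        by rewrite /P p' form_atD addrAC.
      apply: le_trans (ler_normD _ _) _.
      have h1 : `|form_at a (p + t *: v) - form_at a p| <= L * `|v|.
        apply: le_trans (b1 a p (t *: v) pr pr') _.
        rewrite -mulrA ler_wpM2l//; apply: le_trans (_ : 1 * `|v| <= _).
          by rewrite ler_pM.
        by rewrite mul1r.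
      have h2 := b0 v _ pr'; lra.
    have hB : `|E1 + E2 + t *: (tv t *m (P t - ta t))|
        <= (2 * L + K%:R * (L * (2 * L))) * (`|v| * `|v|).
      apply: le_trans (ler_normD _ _) _; rewrite mulrDl.
      apply: lerD.
        apply: le_trans (ler_normD _ _) _.
        by rewrite -mulrA mulr2n mulrDl mul1r lerD.
      rewrite normrZ (ger0_norm t0).
      apply: le_trans (_ : 1 * (K%:R * ((L * `|v|) * (2 * L * `|v|))) <= _).
        apply: ler_pM => //; apply: le_trans (mulmx_norm_le _ _) _.
        by rewrite ler_wpM2l// ler_pM.
      by rewrite le_eqVlt; apply/orP; left; apply/eqP; move: (`|v|) => q; ring.
    apply: le_trans (ler_normD _ _) _; apply: lerD.
      apply: le_trans (mulmx_norm_le _ _) _.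
      by rewrite mulrCA mulrC ler_wpM2r.
    apply: le_trans (mulmx_norm_le _ _) _.
    apply: le_trans (_ : K%:R * ((2 * `|e|) *
        ((2 * L + K%:R * (L * (2 * L))) * (`|v| * `|v|))) <= _).
      by rewrite ler_wpM2l// ler_pM// Xbound.
    rewrite le_eqVlt; apply/orP; left; apply/eqP; rewrite /C.
    by move: (`|v|) (`|e|) => q q'; field.
  have one : 0 <= (1 : R) <= 1 by rewrite ler01 lexx.
  have := linear_growth_bound isZ Z0 bZ one.
  have -> : 2 * (C / 2 * (`|v| * `|v|)) = C * (`|v| * `|v|).
    by move: (`|v|) => q; field.
  by rewrite /Z !scale1r /tv scale1r /om av -/a [y0 + a]addrC subrK.
(* the candidate differential of [om] at [y], as a matrix *)
pose Mx : 'M[R]_(d, K) := \matrix_i (om y *m H i y).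
have MxE u : u *m Mx = om y *m form_at u y.
  rewrite mulmx_sum_row /form_at mulmx_sumr; apply: eq_bigr => i _.
  by rewrite rowK scalemxAr.
have [h1 h2] : is_diff y om (mulmxr Mx).
  apply: differentiable_estimate.
    move=> x; apply: continuous_mulmx; first exact: cvg_id.
    exact: cst_continuous.
  move=> eps eps0.
  have C1 : 0 < C + 1 by rewrite ltr_wpDl.
  have n1 : \forall v \near (0 : 'rV[R]_d), `|v| < eps / (C + 1).
    apply/nbhs_norm0P; exists (eps / (C + 1)); first exact: divr_gt0.
    by [].
  have n2 : \forall v \near (0 : 'rV[R]_d), `|v| < r - `|y - y0|.
    apply/nbhs_norm0P; exists (r - `|y - y0|); first by rewrite /= subr_gt0.
    by [].
  apply: filterS (filterI n1 n2) => v [v1 v2]; rewrite [v + y]addrC /= MxE.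
  have yvr : `|y + v - y0| < r.
    rewrite addrAC; apply: le_lt_trans (ler_normD _ _) _.
    by rewrite -ltrBrDl.
  apply: le_trans (est v yvr) _; rewrite mulrA ler_wpM2r//.
  have : `|v| * (C + 1) < eps by rewrite -ltr_pdivlMr.
  have := normr_ge0 v; nra.
split=> // u; rewrite deriveE// h2 /=.
exact: MxE.
Qed.

End FlatSystem.

(** * Local inversion *)

(** Eliminate the first variable: the Schur complement
    [S - b^T b / a] of the corner [a] is again positive definite. *)
Lemma cholesky (R : realType) n (G : 'M[R]_n) :
  G^T = G -> (forall v, v != 0 -> 0 < ip G v v) -> exists d : 'M[R]_n, d *m d^T = G.
Proof.
elim: n G => [|n IH] G symG posG.
  by exists 0; apply/matrixP => -[].
rewrite -[n.+1]/(1 + n)%N in G symG posG *.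
pose a := G 0 0; pose b : 'M[R]_(1, n) := ursubmx G; pose S := drsubmx G.
have ea : ulsubmx G = a%:M.
  by rewrite [ulsubmx G]mx11_scalar !mxE; congr (G _ _)%:M; apply/val_inj.
have eb : dlsubmx G = b^T by rewrite -[in LHS]symG -trmx_ursub.
have eG : G = block_mx a%:M b b^T S by rewrite -ea -eb submxK.
have symS : S^T = S by rewrite trmx_drsub symG.
have a0 : 0 < a.
  have := posG (row_mx 1%:M 0).
  rewrite row_mx_eq0 negb_and oner_eq0 => /(_ isT).
  rewrite /ip {1}eG tr_row_mx mul_row_block mul_row_col !mul0mx !mul1mx trmx0 mulmx0.
  by rewrite trmx1 mulmx1 !addr0 mxE.
have an0 : a != 0 by rewrite gt_eqF.
pose q := Num.sqrt a.
have qq : q * q = a by rewrite -expr2 sqr_sqrtr// ltW.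
have q0 : q != 0 by rewrite gt_eqF// sqrtr_gt0.
have [||d hd] := IH (S - a^-1 *: (b^T *m b)).
- by rewrite linearB linearZ/= trmx_mul trmxK symS.
- move=> v v0; have := posG (row_mx (- a^-1 *: (v *m b^T)) v).
  rewrite row_mx_eq0 negb_and v0 orbT => /(_ isT).
  rewrite /ip {1}eG tr_row_mx mul_row_block mul_row_col.
  rewrite mul_mx_scalar scalerA mulrN mulfV// scaleN1r addNr mul0mx add0r.
  rewrite -scalemxAl mulmxBr mulmxBl -scalemxAr -scalemxAl addrC.
  by rewrite scaleNr mulmxDl mulNmx -scalemxAl !mulmxA.
exists (block_mx q%:M 0 (q^-1 *: b^T) d).
rewrite tr_block_mx mulmx_block !trmx0 !mul0mx !mulmx0 !addr0 tr_scalar_mx.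
rewrite -scalar_mxM qq mul_scalar_mx linearZ/= trmxK scalerA mulfV// scale1r.
rewrite mul_mx_scalar scalerA mulfV// scale1r hd -scalemxAl -scalemxAr scalerA -invfM qq.
by rewrite addrC subrK -eG.
Qed.

(** A map that differs from the identity by a 1/2-Lipschitz map is injective, and
    its image is open by fixed-point iteration of [y |-> y - (F y - w)]. *)
Section NearIdentity.
Context {R : realType} {n : nat} (y0 : 'rV[R]_n) (r : R).
Variable F : 'rV[R]_n -> 'rV[R]_n.
Hypothesis nearid : forall y z, `|y - y0| < r -> `|z - y0| < r ->
  `|F y - F z - (y - z)| <= 2^-1 * `|y - z|.

Lemma near_identity_inj y z : `|y - y0| < r -> `|z - y0| < r -> F y = F z -> y = z.
Proof.
move=> yr zr e; have := nearid yr zr; rewrite e subrr sub0r normrN => h.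
by apply/eqP; rewrite -subr_eq0 -normr_le0; have := normr_ge0 (y - z); lra.
Qed.

Lemma near_identity_open y1 : `|y1 - y0| < r -> exists2 s : R, 0 < s &
  forall w, `|w - F y1| <= s -> exists2 y, `|y - y0| < r & F y = w.
Proof.
move=> y1r; pose s := (r - `|y1 - y0|) / 2.
have s0 : 0 < s by rewrite divr_gt0// subr_gt0.
have in_r z : `|z - y1| <= s -> `|z - y0| < r.
  move=> zs; have -> : z - y0 = (z - y1) + (y1 - y0) by rewrite addrA subrK.
  apply: le_lt_trans (ler_normD _ _) _; move: zs s0; rewrite /s; lra.
(* the iteration stays in the closed ball of radius [s] around [y1]: a step
   moves [y1] by at most [s / 2] and halves the distance to [y1] *)
exists (s / 2); first by rewrite divr_gt0.
move=> w ws; pose T y := y - (F y - w).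
have contr y z : `|y - y1| <= s -> `|z - y1| <= s -> `|T y - T z| <= 2^-1 * `|y - z|.
  move=> ys zs; apply: le_trans (nearid (in_r _ ys) (in_r _ zs)).
  have -> : T y - T z = - (F y - F z - (y - z)).
    apply/matrixP => i j; rewrite !mxE; ring.
  by rewrite normrN.
have y1s : `|y1 - y1| <= s by rewrite subrr normr0 ltW.
have Ty1 : `|T y1 - y1| <= s / 2.
  by rewrite /T addrC addKr normrN distrC.
have Ts y : `|y - y1| <= s -> `|T y - y1| <= s.
  move=> ys; have := contr _ _ ys y1s => h.
  have -> : T y - y1 = (T y - T y1) + (T y1 - y1) by rewrite addrA subrK.
  apply: le_trans (ler_normD _ _) _; lra.
pose x k := iter k T y1.
have xs k : `|x k - y1| <= s by elim: k => [//|k IH]; exact: Ts.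
have step k : `|x k.+1 - x k| <= (s / 2) / 2 ^+ k.
  elim: k => [|k IH]; first by rewrite expr0 divr1.
  apply: le_trans (contr _ _ (xs k.+1) (xs k)) _.
  by rewrite exprS invfM mulrCA ler_wpM2l.
have [l hl] := mx_geometric_limit step.
have ls : `|l - y1| <= s.
  apply/ler_addgt0Pl => e e0; have [k hk] := geometric_small (2 * (s / 2)) e0.
  have -> : l - y1 = - (x k - l) + (x k - y1) by rewrite opprB addrA subrK.
  apply: le_trans (ler_normD _ _) _; rewrite normrN lerD//.
  exact: le_trans (hl k) hk.
exists l; first exact: in_r.
suff : T l = l.
  by move/eqP; rewrite /T -subr_eq0 addrAC subrr sub0r oppr_eq0 subr_eq0 => /eqP.
apply/eqP; rewrite -subr_eq0 -normr_le0; apply/ler_addgt0Pl => e e0; rewrite addr0.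
have e2 : 0 < e / 2 by rewrite divr_gt0.
have [k hk] := geometric_small (2 * (s / 2)) e2.
have -> : T l - l = - (x k.+1 - T l) + (x k.+1 - l) by rewrite opprB addrA subrK.
apply: le_trans (ler_normD _ _) _; rewrite normrN.
have h1 := contr _ _ (xs k) ls; have h2 := hl k; have h3 := hl k.+1.
have h4 : 2 * (s / 2) / 2 ^+ k.+1 <= 2 * (s / 2) / 2 ^+ k.
  apply: ler_wpM2l; first by apply: mulr_ge0 => //; apply: divr_ge0 => //; exact: ltW.
  by rewrite lef_pV2 ?posrE ?exprn_gt0// ler_eXn2l ?ltr1n.
change (T (x k)) with (x k.+1) in h1.
have := normr_ge0 (x k - l); lra.
Qed.

End NearIdentity.

Local Opaque jacobian.

Lemma open_norm_ball (R : realType) n (y0 : 'rV[R]_n) (r : R) :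
  open [set y | `|y - y0| < r].
Proof.
rewrite (_ : [set y | _] = ball y0 r); first exact: ball_open.
by apply/seteqP; split => y; rewrite -ball_normE /= distrC.
Qed.

(** Composed with the inverse of its Jacobian at [y0], the map is a perturbation
    of the identity near [y0]. *)
Lemma smooth_local_inverse (R : realType) n (U : set 'rV[R]_n)
    (phi : 'rV[R]_n -> 'rV[R]_n) (y0 : 'rV[R]_n) :
  open U -> smooth_on U phi -> U y0 -> 'J phi y0 \in unitmx ->
  exists2 r0 : R, 0 < r0 & forall r, 0 < r -> r <= r0 ->
    (forall y z : 'rV[R]_n, `|y - y0| < r -> `|z - y0| < r -> phi y = phi z -> y = z) /\
    open (phi @` [set y | `|y - y0| < r]).
Proof.
move=> oU sphi Uy0 uJ; have [Q JQ QJ] : exists2 Q, 'J phi y0 *m Q = 1%:M & Q *m 'J phi y0 = 1%:M.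
  by exists (invmx ('J phi y0)); [exact: mulmxV|exact: mulVmx].
have alg (dp p v : 'rV[R]_n) (A B : 'M[R]_n) : dp = v *m A -> B *m Q = 1%:M ->
    dp *m Q + p *m 0 - v = v *m ((A - B) *m Q).
  by move=> -> BQ; rewrite mulmx0 addr0 mulmxBl BQ mulmxBr mulmx1 mulmxA.
have alg2 (A B : 'M[R]_n) : `|(A - A) *m Q - (B - A) *m Q| = `|(B - A) *m Q|.
  by rewrite subrr mul0mx sub0r normrN.
have alg3 (p q y z : 'rV[R]_n) : p - y - (q - z) = p - q - (y - z).
  by apply/matrixP => i j; rewrite !mxE; ring.
pose H y := phi y *m Q - y.
have sH : smooth_on U H.
  apply: smoothD => //; first by apply: smooth_mul => //; exact: smooth_cst.
  by apply: smoothN => //; exact: smooth_id.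
have dphi y : U y -> differentiable phi y by exact: smooth_differentiable.
have dH y v : U y -> 'D_v H y = v *m (('J phi y - 'J phi y0) *m Q).
  move=> Uy.
  have h := is_derive_mulmx (smooth_is_derive v sphi Uy) (is_derive_cst Q y v).
  have [_ ->] := is_deriveB h (is_derive_id y v).
  exact: (alg _ _ _ _ _ (deriveEjacobian v (dphi y Uy)) JQ).
pose eps : R := 2^-1 / (n%:R + 1).
have n0 : 0 < n%:R + 1 :> R by rewrite ltr_wpDl.
have eps0 : 0 < eps by rewrite divr_gt0// invr_gt0.
have n1 : \forall y \near y0, `|('J phi y - 'J phi y0) *m Q| <= eps.
  have sK : smooth_on U (fun y => ('J phi y - 'J phi y0) *m Q).
    apply: smooth_mul => //; last exact: smooth_cst.
    by apply: smoothD => //; [exact: smooth_jacobian|exact: smooth_cst].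
  have cK := differentiable_continuous (smooth_differentiable sK Uy0).
  have /cvgrPdist_le/(_ eps eps0) := cK; apply: filterS => y.
  by rewrite (alg2 ('J phi y0) ('J phi y)).
have n2 : \forall y \near y0, U y by exact: open_nbhs_nbhs.
have n12 : \forall y \near y0, `|('J phi y - 'J phi y0) *m Q| <= eps /\ U y.
  exact: filterI n1 n2.
have /nbhs_ballP[r0 /= r00 hr0] := n12.
exists r0 => // r rp rr0.
have inb y : `|y - y0| < r -> `|('J phi y - 'J phi y0) *m Q| <= eps /\ U y.
  by move=> yr; apply: hr0; rewrite -ball_normE /= distrC (lt_le_trans yr).
have nearid y z : `|y - y0| < r -> `|z - y0| < r ->
    `|phi y *m Q - phi z *m Q - (y - z)| <= 2^-1 * `|y - z|.
  move=> yr zr.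
  have := @lipschitz_on_segment _ _ U _ _ H z (y - z) (2^-1 * `|y - z|) sH.
  have -> : z + (y - z) = y by rewrite addrC subrK.
  have -> : H y - H z = phi y *m Q - phi z *m Q - (y - z).
    exact: alg3.
  apply=> t t01; have [b Ut] := inb _ (ball_segment zr yr t01); split=> //.
  rewrite (dH _ _ Ut); apply: le_trans (mulmx_norm_le _ _) _.
  rewrite mulrCA mulrC ler_wpM2r//.
  apply: le_trans (_ : n%:R * eps <= _); first by rewrite ler_wpM2l.
  by rewrite /eps mulrCA ler_piMr ?invr_ge0// ler_pdivrMr// mul1r lerDl.
split=> [y z yr zr e|].
  by apply: (near_identity_inj nearid) => //=; rewrite e.
rewrite openE => _ [y1 /= y1r <-].
have [s s0 hs] := near_identity_open nearid y1r.
have nQ0 : 0 < n%:R * `|Q| + 1 by rewrite ltr_wpDl// mulr_ge0.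
apply/nbhs_ballP; exists (s / (n%:R * `|Q| + 1)); first exact: divr_gt0.
move=> w; rewrite -ball_normE /= distrC ltr_pdivlMr// => hw.
have [|y yr e] := hs (w *m Q).
  rewrite -mulmxBl; apply: le_trans (mulmx_norm_le _ _) _.
  apply: ltW; apply: le_lt_trans hw.
  by rewrite mulrCA ler_wpM2l// lerDl.
exists y => //=; rewrite -[LHS]mulmx1 -[RHS]mulmx1 -QJ !mulmxA.
by rewrite e.
Qed.

(** * Developing a flat metric *)

Section SmoothBlock.
Context {R : realType} {d : nat} (V : set 'rV[R]_d) (oV : open V).

Lemma smooth_block m1 m2 n1 n2 (A : 'rV[R]_d -> 'M[R]_(m1, n1)) (B : 'rV[R]_d -> 'M[R]_(m1, n2))
    (C : 'rV[R]_d -> 'M[R]_(m2, n1)) (D : 'rV[R]_d -> 'M[R]_(m2, n2)) :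
  smooth_on V A -> smooth_on V B -> smooth_on V C -> smooth_on V D ->
  smooth_on V (fun y => block_mx (A y) (B y) (C y) (D y)).
Proof.
move=> sA sB sC sD i j k.
case: (split_ordP i) => i' ->; case: (split_ordP j) => j' ->.
- by under eq_fun do rewrite block_mxEul; exact: sA.
- by under eq_fun do rewrite block_mxEur; exact: sB.
- by under eq_fun do rewrite block_mxEdl; exact: sC.
- by under eq_fun do rewrite block_mxEdr; exact: sD.
Qed.

Lemma is_derive_block m1 m2 n1 n2 (A : 'rV[R]_d -> 'M[R]_(m1, n1)) (B : 'rV[R]_d -> 'M[R]_(m1, n2))
    (C : 'rV[R]_d -> 'M[R]_(m2, n1)) (D : 'rV[R]_d -> 'M[R]_(m2, n2)) y v dA dB dC dD :
  is_derive y v A dA -> is_derive y v B dB -> is_derive y v C dC -> is_derive y v D dD ->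
  is_derive y v (fun y => block_mx (A y) (B y) (C y) (D y)) (block_mx dA dB dC dD).
Proof.
move=> hA hB hC hD; apply: is_derive_mx => i j.
case: (split_ordP i) => i' ->; case: (split_ordP j) => j' ->.
- by rewrite block_mxEul; under eq_fun do rewrite block_mxEul; exact: is_derive_entry.
- by rewrite block_mxEur; under eq_fun do rewrite block_mxEur; exact: is_derive_entry.
- by rewrite block_mxEdl; under eq_fun do rewrite block_mxEdl; exact: is_derive_entry.
- by rewrite block_mxEdr; under eq_fun do rewrite block_mxEdr; exact: is_derive_entry.
Qed.

End SmoothBlock.

(** The equation expresses the partial derivatives of [om] by [om] itself, so
    each degree of differentiability yields the next one. *)
Lemma smooth_solution (R : realType) d K (U : set 'rV[R]_d)
    (H : 'I_d -> 'rV[R]_d -> 'M[R]_K) (om : 'rV[R]_d -> 'rV[R]_K) :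
  open U -> (forall i, smooth_on U (H i)) ->
  (forall y, U y -> differentiable om y /\ forall u, 'D_u om y = om y *m form_at H u y) ->
  smooth_on U om.
Proof.
move=> oU sH hom i j k; rewrite {i}ord1.
have dom y u : U y -> is_derive y u om (om y *m form_at H u y).
  by move=> Uy; have [h <-] := hom y Uy; apply: derivableP; exact: diff_derivable.
have ddom y l : U y -> differentiable (fun z => om z 0 l) y.
  move=> Uy; have [h _] := hom y Uy.
  have := @differentiable_comp _ _ _ _ om (fun v => v 0 l) y h.
  by apply; exact: differentiable_coord.
elim: k j => [|k IH] j.
  by move=> y Uy; exact: (differentiable_continuous (ddom y j Uy)).
split=> [y Uy|i]; first exact: ddom.
apply: (@Ck_ext _ _ _ _ (fun y => \sum_l om y 0 l * form_at H (delta_mx 0 i) y l j)) => //.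
  move=> y Uy; rewrite /partial.
  by have [_ ->] := is_derive_entry 0 j (dom y (delta_mx 0 i) Uy); rewrite mxE.
apply: Ck_sum => // l; apply: CkM => //.
exact: (smooth_form_at oU sH).
Qed.
Local Opaque conn_form.

Lemma sum_block (R : realType) (I : Type) (s : seq I) m1 m2 n1 n2
    (A : I -> 'M[R]_(m1, n1)) (B : I -> 'M[R]_(m1, n2))
    (C : I -> 'M[R]_(m2, n1)) (D : I -> 'M[R]_(m2, n2)) :
  \sum_(i <- s) block_mx (A i) (B i) (C i) (D i) =
  block_mx (\sum_(i <- s) A i) (\sum_(i <- s) B i) (\sum_(i <- s) C i) (\sum_(i <- s) D i).
Proof.
elim: s => [|i s IH]; first by apply/eqP; rewrite !big_nil eq_sym block_mx_eq0 !eqxx.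
by rewrite !big_cons IH add_block_mx.
Qed.

Section DevelopingMap.
Context {R : realType} {n : nat} {V : set 'rV[R]_n} {G : 'rV[R]_n -> 'M[R]_n}.
Hypothesis oV : open V.
Hypothesis sG : smooth_on V G.
Hypothesis symG : forall y, V y -> (G y)^T = G y.
Hypothesis posG : forall y, V y -> forall v, v != 0 -> 0 < ip (G y) v v.
Hypothesis flatG : forall u v y, V y -> @curv_form R n G u v y = 0.
Implicit Types (u v w y : 'rV[R]_n).

Let C := conn_form G.
Let sC w : smooth_on V (C w). Proof. exact: smooth_conn_form. Qed.

(** The system for a function and its differential, [om = (phi, d phi)]: the
    derivative of [phi] along [u] is [d phi *m u^T], and [d phi] is parallel for the
    connection dual to [C]. *)
Let H (i : 'I_n) y : 'M[R]_(1 + n) :=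
  block_mx 0 0 (delta_mx 0 i)^T (C (delta_mx 0 i) y)^T.

Let form_atH w : form_at H w = fun y => block_mx 0 0 w^T (C w y)^T.
Proof.
apply/funext => y; rewrite /form_at /H.
under eq_bigr do rewrite scale_block_mx !scaler0.
rewrite sum_block !big1_eq; congr block_mx.
  rewrite [w in RHS]row_sum_delta linear_sum/=; apply: eq_bigr => i _.
  by rewrite linearZ.
rewrite /C (conn_form_sum G y w) linear_sum/=; apply: eq_bigr => i _.
by rewrite linearZ.
Qed.

Let sH i : smooth_on V (H i).
Proof.
apply: smooth_block => //; [exact: smooth_cst|exact: smooth_cst|exact: smooth_cst|].
exact: smooth_tr.
Qed.

(** The integrability condition consists of torsion-freeness, in the lower left
    block, and of flatness, in the lower right block. *)
Let flatH u v y : V y ->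
  'D_u (form_at H v) y - 'D_v (form_at H u) y =
  form_at H v y *m form_at H u y - form_at H u y *m form_at H v y.
Proof.
move=> Vy.
have D a b : 'D_a (form_at H b) y = block_mx 0 0 0 ('D_a (C b) y)^T.
  have h := is_derive_trmx (smooth_is_derive a (sC b) Vy).
  have z m1 m2 (X : 'M[R]_(m1, m2)) : is_derive y a (fun=> X) 0.
    exact: (is_derive_cst X y a).
  rewrite form_atH.
  have := @is_derive_block R n 1 n 1 n (fun=> 0) (fun=> 0) (fun=> b^T)
    (fun z => (C b z)^T) y a 0 0 0 _ (z _ _ 0) (z _ _ 0) (z _ _ b^T) h.
  by move=> [_ ->].
rewrite (D u v) (D v u) !form_atH.
have := torsion_free oV symG u v Vy; have := flatG u v Vy; rewrite /curv_form -/C.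
move: ('D_u _ _) ('D_v _ _) (C u y) (C v y) => A B Cu Cv h tf.
rewrite !mulmx_block !mul0mx !mulmx0 !addr0 !add0r !opp_block_mx !add_block_mx.
rewrite !subrr -!trmx_mul tf subrr; congr block_mx.
rewrite -!linearB/=; congr (_^T).
by apply/subr0_eq; rewrite -h; mx_ring.
Qed.

(** Solving the system with the covectors of an orthonormal coframe at [y0] as
    initial values gives [n] functions [phi].  The defect [E] of orthonormality of their
    differentials solves a linear equation and vanishes at [y0]; on a ball small
    enough for [linear_growth_bound] it vanishes identically. *)
Theorem developing_map y0 : V y0 ->
  exists2 r : R, 0 < r & exists phi : 'rV[R]_n -> 'rV[R]_n,
    [/\ forall y, `|y - y0| < r -> V y,
        smooth_on [set y | `|y - y0| < r] phi &
        forall y, `|y - y0| < r -> 'J phi y *m ('J phi y)^T = G y].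
Proof.
move=> Vy0.
have [d0 hd0] := cholesky (symG Vy0) (posG Vy0).
have [r1 r10 [inV1 sol]] := flat_system_solvable oV sH Vy0 flatH.
have [r2 [L [[r20 L0] inV2 bC _ _]]] := form_at_bounds oV (fun i => sC (delta_mx 0 i)) Vy0.
have form_atC w y : form_at (fun i => C (delta_mx 0 i)) w y = C w y.
  by rewrite /form_at /C -conn_form_sum.
have ex k : exists om : 'rV[R]_n -> 'rV[R]_(1 + n), om y0 = row_mx 0 (col k d0)^T /\
    forall y, `|y - y0| < r1 ->
      differentiable om y /\ forall u, 'D_u om y = om y *m form_at H u y.
  by have [om h1 h2] := sol (row_mx 0 (col k d0)^T); exists om.
pose om k := sval (cid (ex k)).
have om0 k : om k y0 = row_mx 0 (col k d0)^T by rewrite /om; case: cid => ? [].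
have omP k y : `|y - y0| < r1 ->
    differentiable (om k) y /\ forall u, 'D_u (om k) y = om k y *m form_at H u y.
  by rewrite /om; case: cid => ? [? h]; exact: h.
have som k : smooth_on [set y | `|y - y0| < r1] (om k).
  apply: (smooth_solution _ _ (omP k)); first exact: open_norm_ball.
  by move=> i; apply: smooth_sub (sH i) => y; exact: inV1.
have om_eq k y u : `|y - y0| < r1 -> is_derive y u (om k)
    (row_mx (rsubmx (om k y) *m u^T) (rsubmx (om k y) *m (C u y)^T)).
  move=> yr; have [h1 h2] := omP k y yr.
  have -> : row_mx (rsubmx (om k y) *m u^T) (rsubmx (om k y) *m (C u y)^T) =
      om k y *m form_at H u y.
    by rewrite form_atH -[om k y in RHS]hsubmxK mul_row_block !mulmx0 !add0r.
  by rewrite -h2; apply: derivableP; exact: diff_derivable.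
pose phi y := \row_k om k y 0 (lshift n 0).
pose dd y := \matrix_(j, k) om k y 0 (rshift 1 j).
have is_phi y u : `|y - y0| < r1 -> is_derive y u phi (u *m dd y).
  move=> yr; apply: is_derive_mx => i k; rewrite ord1.
  have -> : (fun z => phi z 0 k) = fun z => om k z 0 (lshift n 0).
    by apply/funext => z; rewrite mxE.
  have -> : (u *m dd y) 0 k = row_mx (rsubmx (om k y) *m u^T)
      (rsubmx (om k y) *m (C u y)^T) 0 (lshift n 0).
    rewrite row_mxEl !mxE; apply: eq_bigr => j _.
    by rewrite !mxE mulrC.
  exact: is_derive_entry (om_eq k y u yr).
have is_dd y u : `|y - y0| < r1 -> is_derive y u dd (C u y *m dd y).
  move=> yr; apply: is_derive_mx => j k.
  have -> : (fun z => dd z j k) = fun z => om k z 0 (rshift 1 j).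
    by apply/funext => z; rewrite mxE.
  have -> : (C u y *m dd y) j k = row_mx (rsubmx (om k y) *m u^T)
      (rsubmx (om k y) *m (C u y)^T) 0 (rshift 1 j).
    rewrite row_mxEr !mxE; apply: eq_bigr => l _.
    by rewrite !mxE mulrC.
  exact: is_derive_entry (om_eq k y u yr).
have sphi : smooth_on [set y | `|y - y0| < r1] phi.
  move=> i k l; have -> : (fun z => phi z i k) = fun z => om k z 0 (lshift n 0).
    by apply/funext => z; rewrite mxE.
  exact: som.
have Jphi y : `|y - y0| < r1 -> 'J phi y = dd y.
  move=> yr; apply/row_matrixP => i; rewrite !rowE.
  rewrite -(deriveEjacobian _ (smooth_differentiable sphi yr)).
  by have [_ ->] := is_phi y (delta_mx 0 i) yr.
pose E y := G y - dd y *m (dd y)^T.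
have sE : smooth_on [set y | `|y - y0| < r1] E.
  have oB : open [set y | `|y - y0| < r1] by exact: open_norm_ball.
  have sdd : smooth_on [set y | `|y - y0| < r1] dd.
    move=> j k l; have -> : (fun z => dd z j k) = fun z => om k z 0 (rshift 1 j).
      by apply/funext => z; rewrite mxE.
    exact: som.
  apply: smoothD => //; first exact: smooth_sub sG.
  by apply: smoothN => //; apply: smooth_mul => //; exact: smooth_tr.
have is_E y u : `|y - y0| < r1 -> is_derive y u E (C u y *m E y + E y *m (C u y)^T).
  move=> yr; have Vy := inV1 y yr.
  have h1 := smooth_is_derive u sG Vy; rewrite (metric_compatible oV sG symG posG u Vy) in h1.
  have h2 := is_derive_mulmx (is_dd y u yr) (is_derive_trmx (is_dd y u yr)).
  apply: is_derive_eq (is_deriveB h1 h2) _.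
  rewrite /E -/C !trmx_mul (symG Vy); move: (C u y) (dd y) (G y) => A D g.
  mx_ring.
have E0 : E y0 = 0.
  rewrite /E -hd0; have -> : dd y0 = d0; last exact: subrr.
  by apply/matrixP => j k; rewrite mxE om0 row_mxEr !mxE.
pose r := Num.min r1 (Num.min r2 (4^-1 / (n%:R * L + 1))).
have NL0 : 0 < n%:R * L + 1 by rewrite ltr_wpDl// mulr_ge0.
have rp : 0 < r by rewrite /r !lt_min r10 r20 divr_gt0// invr_gt0.
have rr1 : r <= r1 by rewrite /r ge_min lexx.
have rr2 : r <= r2 by rewrite /r !ge_min lexx orbT.
have rNL : n%:R * (L * r) <= 4^-1.
  have : r <= 4^-1 / (n%:R * L + 1) by rewrite /r !ge_min lexx !orbT.
  rewrite ler_pdivlMr// => h.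
  by rewrite mulrA mulrC; apply: le_trans h; rewrite ler_wpM2l ?lerDl// ltW.
have E_zero y : `|y - y0| < r -> E y = 0.
  move=> yr; set a := y - y0 in yr *.
  have y00 : `|y0 - y0| < r by rewrite subrr normr0.
  have ray (t : R) : 0 <= t <= 1 -> `|y0 + t *: a - y0| < r.
    by move=> t01; exact: ball_segment y00 yr t01.
  have one : 0 <= (1 : R) <= 1 by rewrite ler01 lexx.
  have := @linear_growth_bound R _ _ (fun t => E (y0 + t *: a))
    (fun t => C a (y0 + t *: a) *m E (y0 + t *: a) + E (y0 + t *: a) *m (C a (y0 + t *: a))^T) 0.
  have -> : y = y0 + 1 *: a by rewrite scale1r /a addrC subrK.
  rewrite mulr0 scale0r addr0 => h; apply/eqP; rewrite -normr_le0.
  apply: h one => [t t01||t t01].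
  - have yr1 := lt_le_trans (ray t t01) rr1.
    have dE : differentiable E (y0 + t *: a).
      exact: (smooth_differentiable sE yr1).
    by have [_ <-] := is_E _ a yr1; exact: is_derive_line.
  - exact: E0.
  - rewrite addr0; set p := y0 + t *: a.
    have hC : n%:R * `|C a p| <= 4^-1.
      apply: le_trans rNL; rewrite ler_wpM2l// -form_atC.
      apply: le_trans (bC a p (lt_le_trans (ray t t01) rr2)) _.
      by rewrite ler_wpM2l// ltW.
    have hCT : `|(C a p)^T| <= `|C a p|.
      by apply: mx_norm_le => // i j; rewrite mxE entry_le_norm.
    apply: le_trans (ler_normD _ _) _.
    have h1 : `|C a p *m E p| <= 4^-1 * `|E p|.
      by apply: le_trans (mulmx_norm_le _ _) _; rewrite mulrA ler_wpM2r.
    have h2 : `|E p *m (C a p)^T| <= 4^-1 * `|E p|.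
      apply: le_trans (mulmx_norm_le _ _) _; rewrite mulrCA mulrC ler_wpM2r//.
      by apply: le_trans hC; rewrite ler_wpM2l.
    have := normr_ge0 (E p); lra.
exists r => //; exists phi; split.
- by move=> y yr; apply: inV1; exact: lt_le_trans yr rr1.
- by apply: smooth_sub sphi => y /= yr; exact: lt_le_trans yr rr1.
- move=> y yr; rewrite (Jphi _ (lt_le_trans yr rr1)).
  by apply/esym/subr0_eq; exact: E_zero.
Qed.

End DevelopingMap.

(** * From charts to manifolds *)

Lemma ip_ext (R : realType) n (S T : 'M[R]_n) :
  (forall u v, ip S u v = ip T u v) -> S = T.
Proof.
move=> h; apply/matrixP => i j; have := h (delta_mx 0 i) (delta_mx 0 j).
by rewrite /ip -!rowE !trmx_delta -!colE !mxE.
Qed.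

Lemma ip_pullback (R : realType) n (T P g : 'M[R]_n) (u v : 'rV[R]_n) :
  P *m P^T = g -> ip 1%:M (u *m (T *m P)) (v *m (T *m P)) = ip (T *m g *m T^T) u v.
Proof. by move=> <-; rewrite ip_mx /ip mulmx1 trmx_mul !mulmxA. Qed.

Lemma open_chart_image (R : realType) (M : topologicalType) n
    (a : @chart R M n) (O : set M) : open O -> open (a @` (dom a `&` O)).
Proof.
move=> oO; rewrite openE => _ [x [dx Ox] <-].
have ix : (a @` dom a) (a x) by exists x.
have n1 : \forall y \near a x, (a @` dom a) y.
  by apply: open_nbhs_nbhs; split=> //; exact: img_open.
have n2 : \forall y \near a x, O (point_at a y).
  apply: (point_at_continuous ix); rewrite coordK//.
  exact: open_nbhs_nbhs.
have : \forall y \near a x, (a @` dom a) y /\ O (point_at a y) by exact: filterI n1 n2.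
apply: filterS => _ [[z dz <-]]; rewrite coordK// => Oz.
by exists z.
Qed.

Lemma open_chart_preimage (R : realType) (M : topologicalType) n
    (a : @chart R M n) (O : set 'rV[R]_n) : open O -> open (dom a `&` a @^-1` O).
Proof.
move=> oO; rewrite openE => x [dx Ox].
apply: filterI; first by apply: open_nbhs_nbhs; split=> //; exact: dom_open.
apply: (Defs.coord_continuous dx); exact: open_nbhs_nbhs.
Qed.

Lemma in_chartE (R : realType) n (M : @manifold R n) (a : idx M) T (h : M -> T) x :
  dom (atlas a) x -> in_chart a h (atlas a x) = h x.
Proof. by move=> dx; rewrite /in_chart /= coordK. Qed.

Lemma jacobian_comp (R : realType) l m n (T : 'rV[R]_l -> 'rV[R]_m)
    (F : 'rV[R]_m -> 'rV[R]_n) y :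
  differentiable T y -> differentiable F (T y) ->
  'J (F \o T) y = 'J T y *m 'J F (T y).
Proof.
move=> dT dF; apply/row_matrixP => i; rewrite !rowE.
rewrite -(deriveEjacobian _ (differentiable_comp dT dF)) mulmxA.
rewrite -(deriveEjacobian _ dT) -(deriveEjacobian _ dF).
by have [_ ->] := is_derive_comp (delta_mx 0 i) dT dF.
Qed.

Section KaehlerManifold.
Context {R : realType} {N : nat} {Mb : @manifold R N}.
Variables (gb : metric Mb) (J : endo_field Mb) (c : R).
Hypothesis hMb : complex_space_form gb J c.
Variable b : idx Mb.

Let V := img (atlas b).
Let G := in_chart b (gb b).
Let Jb := in_chart b (J b).

Lemma chart_open : open V. Proof. exact: img_open. Qed.

Lemma chart_metric_sym y : V y -> (G y)^T = G y.
Proof. by move=> [x dx <-]; rewrite /G in_chartE// met_sym. Qed.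

Lemma chart_metric_pos y : V y -> forall v, v != 0 -> 0 < ip (G y) v v.
Proof. by move=> [x dx <-] v v0; rewrite /G in_chartE// met_pos. Qed.

Lemma chart_metric_smooth : smooth_on V G. Proof. exact: met_smooth. Qed.

Lemma chart_J_smooth : smooth_on V Jb. Proof. exact: endo_smooth. Qed.

Lemma chart_JJ y : V y -> Jb y *m Jb y = - 1%:M.
Proof. by have [[h _ _] _] := hMb; move=> [x dx <-]; rewrite /Jb in_chartE// h. Qed.

Lemma chart_J_isometry y : V y ->
  forall u v, ip (G y) (u *m Jb y) (v *m Jb y) = ip (G y) u v.
Proof.
by have [[_ h _] _] := hMb; move=> [x dx <-] u v; rewrite /Jb /G !in_chartE// h.
Qed.

Lemma chart_J_parallel : parallel_on V G Jb.
Proof. by have [[_ _ h] _] := hMb; exact: h. Qed.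

Lemma chart_hol y : V y -> forall v, v != 0 -> sectional G y v (v *m Jb y) = 4 * c.
Proof.
have [_ h] := hMb; move=> [x dx <-] v v0.
by rewrite /Jb in_chartE//; exact: h.
Qed.

End KaehlerManifold.

(** Around each point, compose a chart with a developing map of the metric in this
    chart. *)
Lemma flat_space_form_euclidean (R : realType) N (Mb : @manifold R N)
    (gb : metric Mb) (J : endo_field Mb) :
  complex_space_form gb J 0 -> euclidean gb.
Proof.
move=> hMb q; have [b dq] := atlas_cover q.
pose V := img (atlas b); pose G := in_chart b (gb b); pose y0 := atlas b q.
have oV : open V by exact: chart_open.
have sG : smooth_on V G by exact: chart_metric_smooth.
have symG y : V y -> (G y)^T = G y by exact: chart_metric_sym.
have posG y : V y -> forall v, v != 0 -> 0 < ip (G y) v v by exact: chart_metric_pos.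
have flatG u v y (Vy : V y) : @curv_form R N G u v y = 0.
  have sJ : smooth_on V (in_chart b (J b)) by exact: chart_J_smooth.
  have JJ := chart_JJ hMb (b := b).
  have isoJ := chart_J_isometry hMb (b := b).
  have parJ := chart_J_parallel hMb (b := b).
  have hol := chart_hol hMb (b := b).
  exact: (curv_form_zero oV sG symG posG sJ JJ isoJ parJ hol Vy).
have Vy0 : V y0 by exists q.
have [r rp [phi [inV sphi phiE]]] := developing_map oV sG symG posG flatG Vy0.
have oB s : open [set y : 'rV[R]_N | `|y - y0| < s] by exact: open_norm_ball.
have y00 s : 0 < s -> `|y0 - y0| < s by rewrite subrr normr0.
have uJ : 'J phi y0 \in unitmx.
  have := posdef_unitmx posG Vy0; rewrite -(phiE _ (y00 _ rp)).
  by rewrite unitmx_mul => /andP[].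
have [r0 r00 hr0] := smooth_local_inverse (oB r) sphi (y00 _ rp) uJ.
pose s := Num.min r r0.
have sp : 0 < s by rewrite lt_min rp.
have sr : s <= r by rewrite ge_min lexx.
have sr0 : s <= r0 by rewrite ge_min lexx orbT.
have [inj_phi open_phi] := hr0 s sp sr0.
pose U := dom (atlas b) `&` atlas b @^-1` [set y | `|y - y0| < s].
have oU : open U by exact: open_chart_preimage.
exists U, (phi \o atlas b); split.
- by split=> //; split=> //=; exact: y00.
- move=> a; have oaU := open_chart_image (a := atlas a) oU.
  apply: (@smooth_comp _ _ _ _ _ _ [set y | `|y - y0| < s]
    (transition (atlas a) (atlas b)) phi oaU).
  + by move=> _ [x [dx [_ Ux]] <-]; rewrite /transition /= coordK.
  + apply: smooth_sub (atlas_smooth a b) => _ [x [dx [dbx _]] <-].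
    by exists x.
  + by apply: smooth_sub sphi => y /= ys; exact: lt_le_trans ys sr.
- move=> x y [dx Ux] [dy Uy] /= e.
  by rewrite -(coordK dx) -(coordK dy) (inj_phi _ _ Ux Uy e).
- suff -> : (phi \o atlas b) @` U = phi @` [set y | `|y - y0| < s] by exact: open_phi.
  apply/seteqP; split => [_ [x [dx Ux] <-]|_ [y ys <-]]; first by exists (atlas b x).
  have [x dx e] := inV y (lt_le_trans ys sr).
  by exists x; [split=> //=; rewrite e|rewrite /= e].
- move=> a x dx [dbx Ux] u v /=.
  have Tx : transition (atlas a) (atlas b) (atlas a x) = atlas b x.
    by rewrite /transition /= coordK.
  have Ur : `|atlas b x - y0| < r by exact: lt_le_trans Ux sr.
  have dT : differentiable (transition (atlas a) (atlas b)) (atlas a x).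
    by apply: (smooth_differentiable (atlas_smooth a b)); exists x.
  have dphi : differentiable phi (transition (atlas a) (atlas b) (atlas a x)).
    by rewrite Tx; exact: (smooth_differentiable sphi Ur).
  have -> : 'J (in_chart a (phi \o atlas b)) (atlas a x) =
      Jac_transition a b x *m 'J phi (atlas b x).
    by have := jacobian_comp dT dphi; rewrite Tx.
  rewrite (met_tensor gb dx dbx); apply: ip_pullback.
  by rewrite (phiE _ Ur) /G in_chartE.
Qed.

(** Read in charts around one point of [M] and its image, the hypotheses are those
    of [codazzi] and [holomorphic_constant_zero]. *)
Lemma holomorphic_curvature_zero (R : realType) (n p : nat) (M : @manifold R n)
    (Mb : @manifold R (n + p)) (gb : metric Mb) (J : endo_field Mb) (c : R)
    (f : M -> Mb) (g : metric M) (xi : field_along f) (A : endo_field M)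
    (hn : (3 <= n)%N)
    (hMb : complex_space_form gb J c)
    (hf : immersion f)
    (hg : induced_metric f gb g)
    (hCR : CR_maximal f J)
    (hxi : distinguished gb J xi)
    (hD : normal_parallel gb xi)
    (hA : shape_operator gb xi A)
    (hnablaA : parallel g A) : c = 0.
Proof.
have [x0 _] := carrier_nonempty M.
have [a dx0] := atlas_cover x0; have [b dfx0] := atlas_cover (f x0).
pose V := img (atlas b); pose G := in_chart b (gb b); pose Jb := in_chart b (J b).
pose F := local_map f a b; pose W := local_dom f a b.
pose y0 := atlas a x0.
have [cf sf rf] := hf.
have oV : open V by exact: chart_open.
have oW : open W.
  by apply: open_chart_image; move/continuousP: cf; apply; exact: dom_open.
have sG : smooth_on V G by exact: chart_metric_smooth.
have symG y : V y -> (G y)^T = G y by exact: chart_metric_sym.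
have posG y : V y -> forall v, v != 0 -> 0 < ip (G y) v v by exact: chart_metric_pos.
have sJ : smooth_on V Jb by exact: chart_J_smooth.
have JJ y : V y -> Jb y *m Jb y = - 1%:M by exact: (chart_JJ hMb).
have isoJ y : V y -> forall u v, ip (G y) (u *m Jb y) (v *m Jb y) = ip (G y) u v.
  exact: (chart_J_isometry hMb).
have parJ : parallel_on V G Jb := chart_J_parallel hMb (b := b).
have hol := chart_hol hMb (b := b).
have Wimg : W `<=` img (atlas a) by move=> _ [x [dx _] <-]; exists x.
have sF : smooth_on W F by exact: sf.
have Fx x : dom (atlas a) x -> F (atlas a x) = atlas b (f x).
  by move=> dx; rewrite /F /local_map /= coordK.
have FV y : W y -> V (F y).
  by move=> [x [dx dfx] <-]; rewrite Fx//; exists (f x).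
pose g' := in_chart a (g a); pose A' := in_chart a (A a).
have sg : smooth_on W g' by apply: smooth_sub Wimg _; exact: met_smooth.
have symg y : W y -> (g' y)^T = g' y by move=> /Wimg; exact: chart_metric_sym.
have posg y : W y -> forall v, v != 0 -> 0 < ip (g' y) v v.
  by move=> /Wimg; exact: chart_metric_pos.
have sA0 : smooth_on (img (atlas a)) A' by exact: endo_smooth.
have sA : smooth_on W A' by exact: smooth_sub Wimg sA0.
have parA u y : W y -> 'D_u A' y = conn_form g' u y *m A' y - A' y *m conn_form g' u y.
  by move=> /Wimg iy; exact: (parallel_derive u sA0 (hnablaA a) iy).
pose xi' := in_chart a (xi b).
have sxi : smooth_on W xi' by exact: field_smooth.
have gE y : W y -> g' y = 'J F y *m G (F y) *m ('J F y)^T.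
  move=> [x [dx dfx] <-]; rewrite /g' /G Fx// !in_chartE//.
  by apply: ip_ext => u v; rewrite (hg a b x dx dfx) ip_mx.
have dxi u y : W y -> nabla_along G F u xi' y = - (u *m A' y *m 'J F y).
  move=> [x [dx dfx] <-]; have := hA a b x dx dfx u.
  by rewrite (hD a b x dx dfx) addr0 /A' in_chartE.
have Wy0 : W y0 by exists x0.
have cod := codazzi oW oV sF FV sG symG posG sg symg posg sA parA sxi gE dxi _ _ _ Wy0.
have Fy0 : F y0 = atlas b (f x0) by exact: Fx.
have Vz := FV _ Wy0.
have [xi1 xiT subDJ] := hxi a b x0 dx0 dfx0.
have freeD := rf a b x0 dx0 dfx0; have dimH := hCR a b x0 dx0 dfx0.
have xiE : xi' y0 = xi b x0 by exact: in_chartE.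
have GE : G (F y0) = gb b (f x0) by rewrite Fy0; exact: in_chartE.
have JE : Jb (F y0) = J b (f x0) by rewrite Fy0; exact: in_chartE.
rewrite -GE in xi1; rewrite -xiE in xi1.
have {}xiT u : ip (G (F y0)) (u *m dmap f a b x0) (xi' y0) = 0 by rewrite GE xiE.
rewrite -JE -xiE in subDJ.
have {}dimH : ((\rank (dmap f a b x0 *m Jb (F y0) :&: dmap f a b x0)%MS)./2)%:R
    = (n%:R - 1) / 2 :> R by rewrite JE.
apply: (holomorphic_constant_zero hn freeD (symG _ Vz) (JJ _ Vz) (isoJ _ Vz) xi1 xiT subDJ
  dimH (K := @curv4 R (n + p) G (F y0)) (posG _ Vz)).
  by move=> u v w; exact: cod.
move=> v w; exact: (orthogonal_bisectional oV sG symG posG sJ JJ isoJ parJ hol Vz).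
Qed.

Theorem theorem2 (R : realType) (n p : nat) (M : @manifold R n)
    (Mb : @manifold R (n + p)) (gb : metric Mb) (J : endo_field Mb) (c : R)
    (f : M -> Mb) (g : metric M) (xi : field_along f) (A : endo_field M)
    (hn : (3 <= n)%N)
    (hMb : complex_space_form gb J c)
    (hf : immersion f)
    (hg : induced_metric f gb g)
    (hCR : CR_maximal f J)
    (hxi : distinguished gb J xi)
    (hD : normal_parallel gb xi)
    (hA : shape_operator gb xi A)
    (hnablaA : parallel g A) :
  euclidean gb.
Proof.
have c0 := holomorphic_curvature_zero hn hMb hf hg hCR hxi hD hA hnablaA.
by rewrite c0 in hMb; exact: flat_space_form_euclidean hMb.
Qed.
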